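(* An invariant almost Hermitian structure $(J=\{\varepsilon_\delta\},\,g=\{\lambda_\delta\})$, $\delta\in R_t$, on the flag manifold $\mathbb F_\Theta$ is $(1,2)$-symplectic (quasi-Kähler) if and only if $$\varepsilon_\delta\lambda_\delta+\varepsilon_\zeta\lambda_\zeta+\varepsilon_\eta\lambda_\eta=0$$ for every $(1,2)$-triple of t-roots $\{\delta,\zeta,\eta\}$.
   Context: Flag manifolds and t-roots. $\mathfrak g$ is a finite-dimensional complex semisimple Lie algebra, $\mathfrak h$ a Cartan subalgebra, $R$ the root system, $B$ the Killing form, $H_\alpha\in\mathfrak h$ the element with $\alpha(X)=B(X,H_\alpha)$, $\mathfrak h_{\mathbb R}$ the real span of the $H_\alpha$, $\Sigma$ a simple system, $R^\pm$ the positive/negative roots. For $\Theta\subset\Sigma$: $R_\Theta=\langle\Theta\rangle\cap R$, $R_\Theta^{\pm}=R_\Theta\cap R^{\pm}$, $R_M=R\setminus R_\Theta$, $R_M^+=R_M\cap R^+$. $G$ is a Lie group with Lie algebra $\mathfrak g$, $P_\Theta$ the normalizer in $G$ of $\mathfrak p_\Theta=\mathfrak h\oplus\sum_{\alpha\in R^+}\mathfrak g_\alpha\oplus\sum_{\alpha\in R_\Theta^-}\mathfrak g_\alpha$, and $\mathbb F_\Theta=G/P_\Theta$. Fix a Weyl basis $X_\alpha\in\mathfrak g_\alpha$ ($B(X_\alpha,X_{-\alpha})=1$, $[X_\alpha,X_\beta]=n_{\alpha,\beta}X_{\alpha+\beta}$ with $n_{\alpha,\beta}$ real and nonzero iff $\alpha+\beta\in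 R$, $n_{\alpha,\beta}=-n_{-\alpha,-\beta}$). Put $\mathfrak u_\alpha=\mathrm{span}_{\mathbb R}\{X_\alpha-X_{-\alpha},\,i(X_\alpha+X_{-\alpha})\}$, $\mathfrak u=i\mathfrak h_{\mathbb R}\oplus\sum_{\alpha\in R^+}\mathfrak u_\alpha$ (a compact real form), $U\subset G$ the corresponding compact group, $K_\Theta=P_\Theta\cap U$, with Lie algebra $\mathfrak k_\Theta=i\mathfrak h_{\mathbb R}\oplus\sum_{\alpha\in R_\Theta^+}\mathfrak u_\alpha$. Then $\mathbb F_\Theta=U/K_\Theta$ with tangent space at the origin $\mathfrak m=\sum_{\alpha\in R_M^+}\mathfrak u_\alpha$. Put $\mathfrak t=\{H\in i\mathfrak h_{\mathbb R}:\alpha(H)=0\ \forall\alpha\in R_\Theta\}$, $k(\alpha)=\alpha|_{\mathfrak t}$; the t-roots are $R_t=k(R_M)$ and $R_t^+=k(R_M^+)$. One has $\mathfrak m=\bigoplus_{\xi\in R_t^+}\mathfrak m_\xi$ with $\mathfrak m_\xi=\sum_{\alpha\in R_M^+,\,k(\alpha)=\xi}\mathfrak u_\alpha$, irreducible pairwise inequivalent $\mathrm{ad}(\mathfrak k_\Theta)$-modules. Invariant almost complex structures. These are the linear maps $J:\mathfrak m\to\mathfrak m$ with $J^2=-\mathrm{Id}$ commuting with $\mathrm{ad}(L)$ for all $L\in\mathfrak k_\Theta$. Each is given by signs $\varepsilon_\delta=\pm1$, $\delta\in R_t$, with $\varepsilon_{-\delta}=-\varepsilon_\delta$, via $JX_\alpha=i\varepsilon_{k(\alpha)}X_\alpha$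 for $\alpha\in R_M$ (complex-linear extension to $\mathfrak m^{\mathbb C}$); write $J=\{\varepsilon_\delta\}$. Vectors of $\mathfrak m^{\mathbb C}$ in the $+i$ (resp. $-i$) eigenspace of $J$ are of type $(1,0)$ (resp. $(0,1)$). Invariant metrics. These are the $\mathrm{ad}(\mathfrak k_\Theta)$-invariant inner products on $\mathfrak m$; they are exactly $g=-\sum_{\xi\in R_t^+}\lambda_\xi B|_{\mathfrak m_\xi\times\mathfrak m_\xi}$ with $\lambda_\xi>0$. Set $\lambda_{-\xi}=\lambda_\xi$ and write $g=\{\lambda_\delta\}$. An invariant almost Hermitian structure is a pair $(g,J)$ of an invariant metric and an invariant almost complex structure (automatically $g(JX,JY)=g(X,Y)$). Kähler form. $\Omega(X,Y)=g(X,JY)$, extended complex-bilinearly to $\mathfrak m^{\mathbb C}$ (and to a $U$-invariant 2-form on $\mathbb F_\Theta$); at the origin, with brackets projected to $\mathfrak m^{\mathbb C}$, $$3\,d\Omega(X,Y,Z)=-\Omega([X,Y],Z)+\Omega([X,Z],Y)-\Omega([Y,Z],X).$$ $(g,J)$ is $(1,2)$-symplectic (quasi-Kähler) if $d\Omega(X,Y,Z)=0$ whenever one of $X,Y,Z$ is of type $(1,0)$ and the other two are of type $(0,1)$. Triples. A zero-sum triple of t-roots is $\{\delta,\zeta,\eta\}\subset R_t$ with $\delta+\zeta+\eta=0$ (entries not necessarily distinct). It is a $(0,3)$-triple (for $J$) if $\varepsilon_\delta=\varepsilon_\zeta=\varepsilon_\eta$, and a $(1,2)$-triple otherwise. *)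

(* Defs.v *)
From HB Require Import structures.
From mathcomp Require Import all_boot all_order all_algebra.
From mathcomp Require Import complex.
From mathcomp Require Import boolp classical_sets functions reals.

Set Implicit Arguments.
Unset Strict Implicit.
Unset Printing Implicit Defensive.

Import Order.TTheory GRing.Theory Num.Theory.

Local Open Scope ring_scope.
Local Open Scope complex_scope.

Section LieAlgebra.
Variables (F : fieldType) (g : vectType F) (br : g -> g -> g).

Record lie_bracket : Prop := LieBracket {
  br_linearl : forall y, linear (br^~ y);
  br_linearr : forall x, linear (br x);
  br_alt : forall x, br x x = 0;
  br_jacobi : forall x y z, br x (br y z) + br y (br z x) + br z (br x y) = 0
}.

Definition ad (x : g) : 'End(g) := linfun (br x).

Definition killing (x y : g) : F :=
  \tr (passmx.mxof (vbasis {:g}) (vbasis {:g}) (ad x \o ad y)%VF).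

Definition lie_prod (V W : {vspace g}) : {vspace g} :=
  <<[seq br x y | x <- vbasis V, y <- vbasis W]>>%VS.

Definition lie_subalgebra (V : {vspace g}) : Prop := (lie_prod V V <= V)%VS.

Definition lie_ideal (V : {vspace g}) : Prop := (lie_prod fullv V <= V)%VS.

Definition lie_solvable (V : {vspace g}) : Prop :=
  exists n, iter n (fun W => lie_prod W W) V = 0%VS.

Definition lie_nilpotent (V : {vspace g}) : Prop :=
  exists n, iter n (lie_prod V) V = 0%VS.

Definition lie_semisimple : Prop :=
  forall V : {vspace g}, lie_ideal V -> lie_solvable V -> V = 0%VS.

Definition cartan_subalgebra (h : {vspace g}) : Prop :=
  [/\ lie_subalgebra h,
      lie_nilpotent h
    & forall x, (forall y, y \in h -> br x y \in h) -> x \in h].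

Definition dual (h : {vspace g}) : Type := 'Hom(subvs_of h, F^o).
HB.instance Definition _ h := Vector.on (dual h).

(* [vsproj h] is the identity on [h], the only place where [ev a] is used. *)
Definition ev (h : {vspace g}) (a : dual h) (H : g) : F := a (vsproj h H).

Definition in_rootspace (h : {vspace g}) (a : dual h) (x : g) : Prop :=
  forall H, H \in h -> br H x = ev a H *: x.

Definition is_root (h : {vspace g}) (a : dual h) : Prop :=
  a != 0 /\ exists2 x : g, x != 0 & in_rootspace a x.

End LieAlgebra.

Definition nat_comb (F : fieldType) (V : vectType F) (s : seq V) (v : V) : Prop :=
  exists c : 'I_(size s) -> nat, v = \sum_(i < size s) s`_i *+ c i.

Definition simple_system (F : fieldType) (V : vectType F) (Rts S : seq V) : Prop :=
  [/\ free S, {subset S <= Rts}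
    & forall a, a \in Rts -> nat_comb S a \/ nat_comb S (- a)].

Section WeylBasis.
Variables (R : realType) (g : vectType R[i]) (br : g -> g -> g).
Variables (h : {vspace g}) (Rts : seq (dual h)).
Variables (X : dual h -> g) (n : dual h -> dual h -> R).

(* The structure constants n(a, -a) are 0: the bracket [X_a, X_(-a)] lies in h
   and is not covered by the bracket formula.  That the X_a form a basis of a
   complement of h is [weyl_span] (directness is automatic, the X_a being
   eigenvectors for distinct nonzero weights). *)
Record weyl_basis : Prop := WeylBasis {
  weyl_rootspace : forall a, a \in Rts -> in_rootspace br a (X a);
  weyl_span : (h + \sum_(a <- Rts) <[X a]>)%VS = fullv;
  weyl_killing : forall a, a \in Rts -> killing br (X a) (X (- a)) = 1;
  weyl_br : forall a b, a \in Rts -> b \in Rts -> a + b != 0 ->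
    br (X a) (X b) = (n a b)%:C *: X (a + b);
  weyl_n0 : forall a b, a \in Rts -> b \in Rts ->
    (n a b != 0) = (a + b \in Rts);
  weyl_nN : forall a b, a \in Rts -> b \in Rts -> n a b = - n (- a) (- b)
}.

End WeylBasis.

Record flag_setting (R : realType) := FlagSetting {
  lie : vectType R[i];
  br : lie -> lie -> lie;
  cart : {vspace lie};
  roots : seq (dual cart);
  simp : seq (dual cart);
  theta : seq (dual cart);
  Xw : dual cart -> lie;
  nstr : dual cart -> dual cart -> R;
  lieP : lie_bracket br;
  semisimpleP : lie_semisimple br;
  cartP : cartan_subalgebra br cart;
  roots_uniq : uniq roots;
  rootsP : forall a, a \in roots <-> is_root br a;
  simpP : simple_system roots simp;
  thetaP : {subset theta <= simp};
  weylP : weyl_basis br roots Xw nstr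
}.

Section RealForms.
Variables (R : realType) (g : vectType R[i]).
Implicit Types V : set g.

Definition rspan (s : seq g) : set g :=
  [set x | exists c : 'I_(size s) -> R, x = \sum_(i < size s) (c i)%:C *: s`_i].

(* For a real subspace V with V and iV meeting only in 0, the complexification
   V + iV is realised inside g: [cparts V z] is the pair (x, y) of elements of
   V such that z = x + i y, for z in V + iV. *)
Definition cparts V (z : g) : g * g :=
  xget (0, 0)
    [set p : g * g | [/\ V p.1, V p.2 & z = p.1 + 'i *: p.2]]%classic.

Definition clinear_ext V (f : g -> g) (z : g) : g :=
  f (cparts V z).1 + 'i *: f (cparts V z).2.

Definition cbilinear_ext V (b : g -> g -> R) (z w : g) : R[i] :=
  let: (x, y) := cparts V z in
  let: (x', y') := cparts V w in
  (b x x' - b y y') +i* (b x y' + b y x').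

End RealForms.

Section Flag.
Variables (R : realType) (D : flag_setting R).

Local Notation g := (lie D).
Local Notation B := (killing (@br R D)).

Definition root_pos (a : dual (cart D)) : Prop := nat_comb (simp D) a.

Definition R_Theta := [seq a <- roots D | a \in <<theta D>>%VS].
Definition R_M := [seq a <- roots D | a \notin R_Theta].
Definition R_Theta_pos := [seq a <- R_Theta | `[< root_pos a >]].
Definition R_M_pos := [seq a <- R_M | `[< root_pos a >]].

(* The element H_a of the Cartan subalgebra dual to a. *)
Definition Hroot (a : dual (cart D)) : g :=
  xget 0 [set H | H \in cart D /\
                  forall Y, Y \in cart D -> ev a Y = B Y H]%classic.

Definition u_gens (s : seq (dual (cart D))) : seq g :=
  flatten [seq [:: Xw a - Xw (- a); 'i *: (Xw a + Xw (- a))] | a <- s].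

Definition ihR_gens : seq g := [seq 'i *: Hroot a | a <- roots D].

Definition k_Theta : set g := rspan (ihR_gens ++ u_gens R_Theta_pos).
Definition mspace : set g := rspan (u_gens R_M_pos).

Definition k_ThetaC : {vspace g} := <<ihR_gens ++ u_gens R_Theta_pos>>%VS.
Definition mC : {vspace g} := <<u_gens R_M_pos>>%VS.

Definition proj_mC (x : g) : g := daddv_pi mC k_ThetaC x.

Definition tspace : set g :=
  [set H | rspan ihR_gens H /\ forall a, a \in R_Theta -> ev a H = 0]%classic.

Definition tdual : Type := {H : g | tspace H} -> R[i].
HB.instance Definition _ := GRing.Zmodule.on tdual.

Definition kres (a : dual (cart D)) : tdual := fun H => ev a (sval H).

Definition R_t : set tdual := [set d | exists2 a, a \in R_M & d = kres a]%classic.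
Definition R_t_pos : set tdual :=
  [set d | exists2 a, a \in R_M_pos & d = kres a]%classic.

Definition mspace_at (xi : tdual) : set g :=
  rspan (u_gens [seq a <- R_M_pos | `[< kres a = xi >]]).

Section Structures.
(* U-invariant tensors on U/K_Theta are identified with their ad(k_Theta)-
   invariant values at the origin.  Only the restrictions of J and gm to
   mspace matter. *)
Variables (J : g -> g) (gm : g -> g -> R).

Record invariant_acs : Prop := InvariantACS {
  acs_m : forall x, mspace x -> mspace (J x);
  acs_linear : forall (c : R) x y, mspace x -> mspace y ->
    J (c%:C *: x + y) = c%:C *: J x + J y;
  acs_sqr : forall x, mspace x -> J (J x) = - x;
  acs_inv : forall L x, k_Theta L -> mspace x -> J (br L x) = br L (J x)
}.

Record invariant_metric : Prop := InvariantMetric {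
  metric_linear : forall (c : R) x y z, mspace x -> mspace y -> mspace z ->
    gm (c%:C *: x + y) z = c * gm x z + gm y z;
  metric_sym : forall x y, mspace x -> mspace y -> gm x y = gm y x;
  metric_pos : forall x, mspace x -> x != 0 -> 0 < gm x x;
  metric_inv : forall L x y, k_Theta L -> mspace x -> mspace y ->
    gm (br L x) y + gm x (br L y) = 0
}.

Definition JC : g -> g := clinear_ext mspace J.

(* J = {eps_d} *)
Record acs_signs (eps : tdual -> R) : Prop := ACSSigns {
  eps_pm1 : forall d, R_t d -> eps d = 1 \/ eps d = -1;
  eps_opp : forall d, R_t d -> eps (- d) = - eps d;
  eps_J : forall a, a \in R_M -> JC (Xw a) = ('i * (eps (kres a))%:C) *: Xw a
}.

(* g = {lambda_d}, i.e. g = - sum_xi lambda_xi B|(m_xi x m_xi); the values of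
   the bilinear form on the summands of mspace = (+)_xi m_xi determine it. *)
Record metric_coefs (lam : tdual -> R) : Prop := MetricCoefs {
  lam_gt0 : forall d, R_t d -> 0 < lam d;
  lam_opp : forall d, R_t d -> lam (- d) = lam d;
  lam_diag : forall d x y, R_t_pos d -> mspace_at d x -> mspace_at d y ->
    (gm x y)%:C = - ((lam d)%:C * B x y);
  lam_orth : forall d e x y, R_t_pos d -> R_t_pos e -> d <> e ->
    mspace_at d x -> mspace_at e y -> gm x y = 0
}.

Definition OmegaC : g -> g -> R[i] := cbilinear_ext mspace (fun x y => gm x (J y)).

(* The exterior derivative at the origin of the invariant 2-form Omega. *)
Definition dOmega (x y z : g) : R[i] :=
  3%:R^-1 * (- OmegaC (proj_mC (br x y)) z
             + OmegaC (proj_mC (br x z)) y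
             - OmegaC (proj_mC (br y z)) x).

Definition type10 (z : g) : Prop := z \in mC /\ JC z = 'i *: z.
Definition type01 (z : g) : Prop := z \in mC /\ JC z = - 'i *: z.

Definition quasi_kahler : Prop := forall x y z : g,
  [\/ [/\ type10 x, type01 y & type01 z],
      [/\ type01 x, type10 y & type01 z]
    | [/\ type01 x, type01 y & type10 z]] -> dOmega x y z = 0.

End Structures.

Definition zero_sum_triple (d z e : tdual) : Prop :=
  [/\ R_t d, R_t z, R_t e & d + z + e = 0].

Definition triple03 (eps : tdual -> R) (d z e : tdual) : Prop :=
  zero_sum_triple d z e /\ eps d = eps z /\ eps z = eps e.

Definition triple12 (eps : tdual -> R) (d z e : tdual) : Prop :=
  zero_sum_triple d z e /\ ~ triple03 eps d z e.

End Flag.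

(* Main.v *)
From HB Require Import structures.
Require Import Defs.
From mathcomp Require Import all_boot all_order all_algebra.
From mathcomp Require Import complex ring.
From mathcomp Require Import boolp classical_sets functions reals.

Local Open Scope ring_scope.

Set Implicit Arguments.
Unset Strict Implicit.
Unset Printing Implicit Defensive.

Import Order.TTheory GRing.Theory Num.Theory.

(* By trilinearity it suffices to evaluate dOmega on root vectors.  As Omega pairs
   X_a only with X_(-a), and as B is invariant,
     3 dOmega(X_a, X_b, X_c)
       = i (eps_a lam_a + eps_b lam_b + eps_c lam_c) B([X_a, X_b], X_c),
   where the last factor is nonzero exactly when a + b + c = 0 (a, b, c roots).
   What remains is to lift a zero-sum triple of t-roots d + z + e = 0 to roots.
   The Weyl basis gives b(H_a) = n(-a, b)^2 - n(a, b)^2 for b <> a, -a, which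
   replaces the usual root strings: b(H_a) < 0 forces a + b to be a root, and
   b(H_a) > 0 forces b - a to be one.  The sum A of the H_a over the fibre of d is
   orthogonal to R_Theta, because a(H_c), c in R_Theta, sums over the fibre to the
   trace of a commutator; and d(A) > 0.  If z(A) < 0, some a over d and b over z
   have a negative product; otherwise (d + z)(A) > 0, and some a over d and c over
   d + z have a positive one. *)

(** * Lie brackets and the Killing form *)

Section LieTheory.
Variables (F : fieldType) (g : vectType F) (br : g -> g -> g).
Hypothesis brP : lie_bracket br.
Implicit Types (x y z : g) (V W U : {vspace g}).

Lemma lie_adE x y : ad br x y = br x y.
Proof.
pose L := HB.pack_for {linear g -> g} (br x)
  (GRing.isLinear.Build F g g *:%R (br x) (br_linearr brP x)).
by rewrite /ad -[br x]/(L : g -> g) lfunE.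
Qed.

Lemma brDr x y z : br x (y + z) = br x y + br x z.
Proof. by rewrite -!lie_adE linearD. Qed.

Lemma brZr x a y : br x (a *: y) = a *: br x y.
Proof. by rewrite -!lie_adE linearZ. Qed.

Lemma brDl x y z : br (x + y) z = br x z + br y z.
Proof. by have := br_linearl brP z 1 x y; rewrite /= !scale1r. Qed.

Lemma brC x y : br x y = - br y x.
Proof.
have := br_alt brP (x + y).
rewrite brDl !brDr !(br_alt brP) addr0 add0r => /eqP.
by rewrite addr_eq0 => /eqP.
Qed.

Lemma brZl x a y : br (a *: x) y = a *: br x y.
Proof. by rewrite brC brZr -scalerN -brC. Qed.

Lemma brNr x y : br x (- y) = - br x y.
Proof. by rewrite -scaleN1r brZr scaleN1r. Qed.

Lemma brNl x y : br (- x) y = - br x y.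
Proof. by rewrite -scaleN1r brZl scaleN1r. Qed.

Lemma br0r x : br x 0 = 0.
Proof. by rewrite -lie_adE linear0. Qed.

Lemma br0l x : br 0 x = 0.
Proof. by rewrite brC br0r oppr0. Qed.

Lemma br_sumr x I (r : seq I) (P : pred I) (f : I -> g) :
  br x (\sum_(i <- r | P i) f i) = \sum_(i <- r | P i) br x (f i).
Proof. by apply: big_morph => [u v|]; [exact: brDr | exact: br0r]. Qed.

Lemma br_suml x I (r : seq I) (P : pred I) (f : I -> g) :
  br (\sum_(i <- r | P i) f i) x = \sum_(i <- r | P i) br (f i) x.
Proof.
by apply: (big_morph (br^~ x)) => [u v|]; [exact: brDl | exact: br0l].
Qed.

Lemma br_derivation x y z : br x (br y z) = br (br x y) z + br y (br x z).
Proof.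
have /eqP := br_jacobi brP x y z; rewrite -addrA addr_eq0 => /eqP ->.
by rewrite opprD addrC (brC z (br x y)) opprK (brC z x) brNr opprK.
Qed.

(** * Traces of endomorphisms and invariance of the Killing form *)

Definition lfun_trace (f : 'End(g)) : F :=
  \tr (passmx.mxof (vbasis {:g}) (vbasis {:g}) f).

Lemma lfun_trace_linear : scalar lfun_trace.
Proof.
by move=> a f1 f2; rewrite /lfun_trace passmx.mxof_linear linearP.
Qed.

Lemma lfun_traceD f1 f2 : lfun_trace (f1 + f2) = lfun_trace f1 + lfun_trace f2.
Proof. by rewrite -[f1]scale1r lfun_trace_linear mul1r scale1r. Qed.

Lemma lfun_traceZ a f : lfun_trace (a *: f) = a * lfun_trace f.
Proof.
have t0 : lfun_trace 0 = 0.
  by apply: (addrI (lfun_trace 0)); rewrite -lfun_traceD !addr0.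
by rewrite -[a *: f]addr0 lfun_trace_linear t0 addr0.
Qed.

Lemma lfun_traceC (f1 f2 : 'End(g)) :
  lfun_trace (f1 \o f2)%VF = lfun_trace (f2 \o f1)%VF.
Proof.
have e := vbasisP {:g}.
by rewrite /lfun_trace !(passmx.mxof_comp _ _ e) mxtrace_mulC.
Qed.

Lemma lfun_traceE f :
  lfun_trace f = \sum_i coord (vbasis {:g}) i (f (vbasis {:g})`_i).
Proof.
rewrite /lfun_trace /mxtrace; apply: eq_bigr => i _.
have e := vbasisP {:g}; have fe := basis_free e.
rewrite [RHS]passmx.coord_rVof (passmx.rVof_app _ e).
have -> : passmx.rVof (vbasis {:g}) (vbasis {:g})`_i = delta_mx 0 i.
  apply/rowP => j; rewrite -passmx.coord_rVof coord_free // mxE eqxx.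
  by rewrite eq_sym.
by rewrite -rowE [RHS]mxE.
Qed.

(** Each summand is a map of rank at most one with trace [phi i (u i)], as expanding [u i] in the
    basis shows. This yields the Killing form on the Cartan subalgebra as a sum over roots without
    building an eigenbasis. *)
Lemma lfun_trace_finite_rank I (s : seq I) (u : I -> g) (phi : I -> g -> F)
    (f : 'End(g)) :
  (forall i, scalar (phi i)) ->
  (forall x, f x = \sum_(i <- s) phi i x *: u i) ->
  lfun_trace f = \sum_(i <- s) phi i (u i).
Proof.
move=> phiP fE; rewrite lfun_traceE.
under eq_bigr do rewrite fE linear_sum.
rewrite exchange_big /=; apply: eq_bigr => k _.
pose L := HB.pack_for {scalar g} (phi k)
  (GRing.isLinear.Build F g F *%R (phi k) (phiP k)).
rewrite -[phi k]/(L : g -> F).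
rewrite {2}[u k](coord_vbasis (memvf _)) linear_sum; apply: eq_bigr => i _.
by rewrite !linearZ /= mulrC.
Qed.

Lemma killingE x y : killing br x y = lfun_trace (ad br x \o ad br y).
Proof. by []. Qed.

Lemma killingC x y : killing br x y = killing br y x.
Proof. exact: lfun_traceC. Qed.

Lemma adD x y : ad br (x + y) = ad br x + ad br y.
Proof. by apply/lfunP => z; rewrite add_lfunE !lie_adE brDl. Qed.

Lemma adZ a x : ad br (a *: x) = a *: ad br x.
Proof. by apply/lfunP => z; rewrite scale_lfunE !lie_adE brZl. Qed.

Lemma killingDl x y z : killing br (x + y) z = killing br x z + killing br y z.
Proof. by rewrite !killingE adD comp_lfunDl lfun_traceD. Qed.

Lemma killingZl a x y : killing br (a *: x) y = a * killing br x y.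
Proof. by rewrite !killingE adZ -lfun_traceZ comp_lfunZl. Qed.

Lemma killingDr x y z : killing br x (y + z) = killing br x y + killing br x z.
Proof. by rewrite !(killingC x) killingDl. Qed.

Lemma killingZr a x y : killing br x (a *: y) = a * killing br x y.
Proof. by rewrite !(killingC x) killingZl. Qed.

Lemma killing0l x : killing br 0 x = 0.
Proof. by rewrite -(scale0r 0) killingZl mul0r. Qed.

Lemma killing0r x : killing br x 0 = 0.
Proof. by rewrite killingC killing0l. Qed.

Lemma killingNl x y : killing br (- x) y = - killing br x y.
Proof. by rewrite -scaleN1r killingZl mulN1r. Qed.

Lemma killingNr x y : killing br x (- y) = - killing br x y.
Proof. by rewrite -scaleN1r killingZr mulN1r. Qed.

Lemma killing_suml x I (r : seq I) (P : pred I) (f : I -> g) :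
  killing br (\sum_(i <- r | P i) f i) x
  = \sum_(i <- r | P i) killing br (f i) x.
Proof.
by apply: (big_morph (fun u => killing br u x)) => [u v|];
  [exact: killingDl | exact: killing0l].
Qed.

Lemma killing_sumr x I (r : seq I) (P : pred I) (f : I -> g) :
  killing br x (\sum_(i <- r | P i) f i)
  = \sum_(i <- r | P i) killing br x (f i).
Proof. by rewrite killingC killing_suml; under eq_bigr do rewrite killingC. Qed.

(** By Jacobi, [ad] of a bracket is the commutator of the operators; cyclicity of the trace does the
    rest. *)
Lemma killing_br x y z : killing br (br x y) z = killing br x (br y z).
Proof.
have adbr u v : ad br (br u v) = ((ad br u \o ad br v) - (ad br v \o ad br u))%VF.
  apply/lfunP => w.
  rewrite lie_adE add_lfunE opp_lfunE !comp_lfunE !lie_adE.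
  by rewrite br_derivation addrK.
rewrite !killingE !adbr comp_lfunDl comp_lfunDr comp_lfunNl comp_lfunNr.
rewrite -!scaleN1r !lfun_traceD !lfun_traceZ -!comp_lfunA.
by rewrite (lfun_traceC (ad br y)) -comp_lfunA.
Qed.

(** * Products of subspaces, nilpotency and solvability *)

Lemma mem_lie_prod V W x y : x \in V -> y \in W -> br x y \in lie_prod br V W.
Proof.
move=> xV yW; rewrite (coord_vbasis xV) (coord_vbasis yW) br_suml.
apply: memv_suml => i _; rewrite brZl br_sumr memvZ //.
apply: memv_suml => j _; rewrite brZr memvZ //; apply: memv_span.
by apply: allpairs_f; apply: mem_nth; rewrite size_tuple.
Qed.

Lemma lie_prod_subP V W U :
  (forall x y, x \in V -> y \in W -> br x y \in U) -> (lie_prod br V W <= U)%VS.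
Proof.
move=> h; apply/span_subvP => _ /allpairsP[[x y] [xV yW ->]].
by apply: h; apply: vbasis_mem.
Qed.

Lemma lie_prodS V V' W W' : (V <= V')%VS -> (W <= W')%VS ->
  (lie_prod br V W <= lie_prod br V' W')%VS.
Proof.
move=> /subvP VV' /subvP WW'.
by apply: lie_prod_subP => x y xV yW; apply: mem_lie_prod; auto.
Qed.

(** The derived series of [W] stays below the lower central series of [V]. The induction also keeps
    the derived terms inside [V], since each lower central term is a product with [V] on the
    left. *)
Lemma nilpotent_solvable V W : lie_subalgebra br V -> lie_nilpotent br V ->
  (W <= V)%VS -> lie_solvable br W.
Proof.
move=> Vsub [n Vn] WV; exists n; apply/eqP; rewrite -subv0 -Vn.
suff [] : (iter n (fun U => lie_prod br U U) W <= V)%VS /\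
  (iter n (fun U => lie_prod br U U) W <= iter n (lie_prod br V) V)%VS by [].
elim: n {Vn} => [|n [IH1 IH2]] //=; split; last exact: lie_prodS.
exact: subv_trans (lie_prodS IH1 IH1) Vsub.
Qed.

End LieTheory.

(** * Linear algebra *)

Section ComplexConjugation.
Variable R : rcfType.
Local Notation C := R[i]%C.

Lemma conjcD (z w : C) : conjc (z + w) = conjc z + conjc w.
Proof. exact: rmorphD. Qed.

Lemma conjcB (z w : C) : conjc (z - w) = conjc z - conjc w.
Proof. exact: rmorphB. Qed.

Lemma conjcM (z w : C) : conjc (z * w) = conjc z * conjc w.
Proof. exact: rmorphM. Qed.

Lemma conjc_i : conjc 'i%C = - 'i%C :> C.
Proof. by apply/eqP; rewrite eq_complex /= oppr0 !eqxx. Qed.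

End ComplexConjugation.

Section Span.
Variables (F : fieldType) (V : vectType F).

Lemma span_ind (s : seq V) (P : V -> Prop) : P 0 ->
  (forall (k : F) x y, x \in s -> P y -> P (k *: x + y)) ->
  forall x, x \in <<s>>%VS -> P x.
Proof.
move=> P0 PD x /(@coord_span _ _ _ (in_tuple s)) ->.
by elim/big_rec: _ => // i y _; apply: PD; exact: mem_nth.
Qed.

Lemma memv_sum_lines (I : eqType) (X : I -> V) (s : seq I) v : uniq s ->
  v \in (\sum_(i <- s) <[X i]>)%VS ->
  exists z : I -> F, v = \sum_(i <- s) z i *: X i.
Proof.
elim: s v => [|j s IHs] v /=.
  by rewrite !big_nil memv0 => _ /eqP ->; exists (fun=> 0); rewrite big_nil.
move=> /andP[js us]; rewrite big_cons => /memv_addP[_ /vlineP[k ->]] [w ws ->].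
have [z ->] := IHs _ us ws.
exists (fun i => if i == j then k else z i).
rewrite big_cons eqxx; congr (_ + _); apply: eq_big_seq => i si.
by rewrite ifN //; apply: contra js => /eqP <-.
Qed.

End Span.

Section RealSpan.
Variables (R : realType) (g : vectType R[i]%C).
Implicit Types (s : seq g) (x y : g).
Local Notation "x %:C" := (real_complex R x).

Lemma rspan0 s : rspan s 0.
Proof.
by exists (fun=> 0); rewrite big1 // => i _; rewrite rmorph0 scale0r.
Qed.

Lemma rspan_linear s (k : R) x y :
  rspan s x -> rspan s y -> rspan s (k%:C *: x + y).
Proof.
move=> [c ->] [d ->]; exists (fun i => k * c i + d i).
rewrite scaler_sumr -big_split; apply: eq_bigr => i _ /=.
by rewrite rmorphD rmorphM /= scalerDl scalerA.
Qed.

Lemma rspanD s x y : rspan s x -> rspan s y -> rspan s (x + y).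
Proof. by rewrite -{2}[x]scale1r; exact: (@rspan_linear _ 1). Qed.

Lemma rspanZ s (k : R) x : rspan s x -> rspan s (k%:C *: x).
Proof. by rewrite -[_ *: x]addr0 => sx; apply: rspan_linear => //; apply: rspan0. Qed.

Lemma rspanN s x : rspan s x -> rspan s (- x).
Proof. by move/(rspanZ (-1)); rewrite rmorphN1 scaleN1r. Qed.

Lemma rspan_sum s I (r : seq I) (P : pred I) (f : I -> g) :
  (forall i, P i -> rspan s (f i)) -> rspan s (\sum_(i <- r | P i) f i).
Proof.
move=> sf; elim/big_rec: _ => [|i x Pi]; [exact: rspan0 | exact: (rspanD (sf i Pi))].
Qed.

Lemma mem_rspan s x : x \in s -> rspan s x.
Proof.
move=> sx; have ix : (index x s < size s)%N by rewrite index_mem.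
exists (fun i => (i == Ordinal ix)%:R); rewrite (bigD1 (Ordinal ix)) //= eqxx.
rewrite rmorph1 scale1r nth_index // big1 ?addr0 // => i /negPf ->.
by rewrite rmorph0 scale0r.
Qed.

Lemma rspan_ind s (P : g -> Prop) : P 0 ->
  (forall (k : R) x y, x \in s -> P y -> P (k%:C *: x + y)) ->
  forall x, rspan s x -> P x.
Proof.
move=> P0 PD x [c ->]; elim/big_rec: _ => // i y _; apply: PD.
exact: mem_nth.
Qed.

Lemma rspanS s s' x : {subset s <= s'} -> rspan s x -> rspan s' x.
Proof.
move=> ss'; move: x; apply: rspan_ind => [|k x y /ss' sx sy]; first exact: rspan0.
by apply: rspan_linear => //; exact: mem_rspan.
Qed.

End RealSpan.

Section DualSpace.
Variables (F : fieldType) (g : vectType F) (h : {vspace g}).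
Implicit Types (a b : dual h) (H : g).

Lemma evD a b H : ev (a + b) H = ev a H + ev b H.
Proof. exact: (@add_lfunE F (subvs_of h) F^o). Qed.

Lemma evN a H : ev (- a) H = - ev a H.
Proof. exact: (@opp_lfunE F (subvs_of h) F^o). Qed.

Lemma ev0 H : ev (0 : dual h) H = 0.
Proof. exact: (@zero_lfunE F (subvs_of h) F^o). Qed.

Lemma evZ k a H : ev (k *: a) H = k * ev a H.
Proof. exact: (@scale_lfunE F (subvs_of h) F^o). Qed.

Lemma evDr a H H' : ev a (H + H') = ev a H + ev a H'.
Proof. by rewrite /ev !linearD. Qed.

Lemma evZr a k H : ev a (k *: H) = k * ev a H.
Proof. by rewrite /ev !linearZ. Qed.

Lemma evNr a H : ev a (- H) = - ev a H.
Proof. by rewrite /ev !linearN. Qed.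

Lemma ev_sumr I (r : seq I) (P : pred I) a (f : I -> g) :
  ev a (\sum_(i <- r | P i) f i) = \sum_(i <- r | P i) ev a (f i).
Proof. by rewrite /ev !linear_sum. Qed.

Lemma dual_eqP a b : (forall H, H \in h -> ev a H = ev b H) -> a = b.
Proof.
move=> ab; apply/lfunP => u.
by have := ab _ (subvsP u); rewrite /ev vsvalK.
Qed.

Lemma dual_neq0P a : a != 0 -> exists2 H, H \in h & ev a H != 0.
Proof.
move=> a0; apply: contrapT => nH; case/eqP: a0; apply: dual_eqP => H hH.
by rewrite ev0; apply: contrapT => /eqP aH; apply: nH; exists H.
Qed.

End DualSpace.

(** * Structure of the root system *)

Section FlagManifold.
Variables (R : realType) (D : flag_setting R).

Local Notation g := (lie D).
Local Notation C := R[i]%C.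
Local Notation h := (cart D).
Local Notation Phi := (Defs.roots D).
Local Notation "{[ x , y ]}" := (@br R D x y) (format "{[ x ,  y ]}").
Local Notation B := (killing (@br R D)).
Local Notation X := (@Xw R D).
Local Notation n := (@nstr R D).
Local Notation "x %:C" := (real_complex R x).
Implicit Types (x y z H Y : g) (a b c : dual h).
Let L := lieP D.
Let W := weylP D.

Lemma root_neq0 a : a \in Phi -> a != 0.
Proof. by move/rootsP => []. Qed.

Lemma br_hX a H : a \in Phi -> H \in h -> {[ H, X a ]} = ev a H *: X a.
Proof. by move=> /(weyl_rootspace W); apply. Qed.

Lemma weyl_decomposition x :
  exists2 H, H \in h & exists z : dual h -> C,
    x = H + \sum_(a <- Phi) z a *: X a.
Proof.
have: x \in fullv by rewrite memvf.
rewrite -(weyl_span W) => /memv_addP[H hH] [y yS ->]; exists H => //.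
by have [z ->] := memv_sum_lines (roots_uniq D) yS; exists z.
Qed.

Lemma cart_lie_subalgebra : lie_subalgebra (@br R D) h.
Proof. by have [] := cartP D. Qed.

(* [h, h] commutes with every root vector, so it is a solvable ideal. *)
Lemma cart_abelian H H' : H \in h -> H' \in h -> {[ H, H' ]} = 0.
Proof.
move=> hH hH'.
suff h0 : lie_prod (@br R D) h h = 0%VS.
  by apply/eqP; rewrite -memv0 -h0 mem_lie_prod.
have [_ hnil _] := cartP D.
have hsub := cart_lie_subalgebra.
apply: (semisimpleP (f := D)); last exact: (nilpotent_solvable L hsub hnil).
apply: lie_prod_subP => // x y _ yh2.
have yh : y \in h by apply: (subvP hsub).
(* Two elements of [h] act on $X_a$ by scalars, which commute, so Jacobi makes their bracket
   annihilate $X_a$. *)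
have yX a : a \in Phi -> {[ X a, y ]} = 0.
  move=> Pa; suff hX : (lie_prod (@br R D) h h <= lker (ad (@br R D) (X a)))%VS.
    by apply/eqP; rewrite -(lie_adE L) -memv_ker (subvP hX).
  apply: lie_prod_subP => H1 H2 hH1 hH2; rewrite memv_ker lie_adE //.
  rewrite br_derivation // !(brC L (X a)) !br_hX // brNl // brNr //.
  rewrite brZl // brZr // (brC L (X a)) !br_hX //.
  by rewrite scalerN opprK !scalerA mulrC subrr.
have [H1 hH1 [z ->]] := weyl_decomposition x.
rewrite brDl // br_suml // big_seq big1 ?addr0 ?mem_lie_prod // => a Pa.
by rewrite brZl // yX // scaler0.
Qed.

(** Such an [H] is central, so its line is a solvable ideal, which semisimplicity forces to be
    zero. *)
Lemma cart_center H : H \in h -> (forall a, a \in Phi -> ev a H = 0) -> H = 0.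
Proof.
move=> hH aH0.
have brH x : {[ x, H ]} = 0.
  have [H1 hH1 [z ->]] := weyl_decomposition x.
  rewrite (brDl L) cart_abelian // add0r (br_suml L) big_seq big1 // => a Pa.
  by rewrite (brZl L) (brC L) br_hX // aH0 // scale0r oppr0 scaler0.
suff : <[H]>%VS = 0%VS by move/eqP; rewrite -subv0 -memvE memv0 => /eqP.
apply: (semisimpleP (f := D)).
  apply: lie_prod_subP => // x _ _ /vlineP[k ->].
  by rewrite (brZr L) brH scaler0 mem0v.
exists 1%N; apply/eqP; rewrite -subv0 /=.
apply: lie_prod_subP => // x _ _ /vlineP[k ->].
by rewrite (brZr L) brH scaler0 mem0v.
Qed.

(** * The Killing form in the Weyl basis *)

Lemma killing_Xh a H : a \in Phi -> H \in h -> B (X a) H = 0.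
Proof.
move=> Pa hH; have [H' hH' aH'] := dual_neq0P (root_neq0 Pa).
apply/eqP; rewrite -(mulrI_eq0 _ (mulfI aH')) -(killingZl L) -br_hX //.
by rewrite (brC L) (killingNl L) (killing_br L) cart_abelian // (killing0r L) oppr0.
Qed.

(** Invariance under the Cartan subalgebra gives $(a+b)(H)\,B(X_a,X_b)=0$, and some $H$ has
    $(a+b)(H)\neq 0$. *)
Lemma killing_XX_eq0 a b : a \in Phi -> b \in Phi -> a + b != 0 ->
  B (X a) (X b) = 0.
Proof.
move=> Pa Pb ab0; have [H hH abH] := dual_neq0P ab0.
apply/eqP; rewrite -(mulrI_eq0 _ (mulfI abH)) evD mulrDl.
rewrite -(killingZl L) -(killingZr L) -!br_hX // (brC L H (X a)) (killingNl L).
by rewrite (killing_br L) addNr.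
Qed.

(** [weyl_killing] gives $B(X_a,X_{-a})=1$ before $-a$ is known to be a root. Were it not one,
    [X (- a)] would be a combination of an element of [h] and of vectors $X_b$ with $b\neq -a$, all
    orthogonal to $X_a$. *)
Lemma root_opp a : a \in Phi -> - a \in Phi.
Proof.
move=> Pa; apply: contraT => PNa.
have [H hH [z XNa]] := weyl_decomposition (X (- a)).
have /eqP := weyl_killing W Pa.
rewrite XNa (killingDr L) killing_Xh // add0r (killing_sumr L) big_seq.
rewrite big1 1?eq_sym ?oner_eq0 // => b Pb.
rewrite (killingZr L) killing_XX_eq0 ?mulr0 //.
by apply: contra PNa; rewrite addrC addr_eq0 => /eqP <-.
Qed.

Lemma killing_XXN a b : a \in Phi -> b \in Phi -> B (X a) (X (- b)) = (a == b)%:R.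
Proof.
move=> Pa Pb; case: eqVneq => [<-|ab]; first exact: weyl_killing W a Pa.
by rewrite killing_XX_eq0 ?root_opp // subr_eq0.
Qed.

Lemma weyl_coordinates x : exists2 H, H \in h &
  x = H + \sum_(a <- Phi) B x (X (- a)) *: X a.
Proof.
have [H hH [z xE]] := weyl_decomposition x; exists H => //.
rewrite {1}xE; congr (_ + _); apply: eq_big_seq => a Pa; congr (_ *: _).
rewrite xE (killingDl L) (killingC _ H) killing_Xh ?root_opp // add0r.
rewrite (killing_suml L) (bigD1_seq a) //= ?roots_uniq // (killingZl L).
rewrite killing_XXN // eqxx mulr1 big_seq_cond big1 ?addr0 // => b /andP[Pb ba].
by rewrite (killingZl L) killing_XXN // (negPf ba) mulr0.
Qed.

(** The composite of the two operators kills [h] and multiplies $X_a$ by $a(H)a(H')$. Reading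
    coordinates as $B(x,X_{-a})$ presents it as a sum of rank-one maps. *)
Lemma killing_cart H H' : H \in h -> H' \in h ->
  B H H' = \sum_(a <- Phi) ev a H * ev a H'.
Proof.
move=> hH hH'; rewrite killingE.
pose phi a x : C := ev a H * ev a H' * B x (X (- a)).
rewrite (lfun_trace_finite_rank (s := Phi) (u := X) (phi := phi)).
- by apply: eq_big_seq => a Pa; rewrite /phi killing_XXN // eqxx mulr1.
- by move=> a k x y; rewrite /phi (killingDl L) (killingZl L) mulrDr mulrCA.
move=> x; rewrite comp_lfunE !lie_adE //.
have [H1 hH1 xE] := weyl_coordinates x; rewrite [in LHS]xE.
rewrite !(brDr L, br_sumr L). rewrite (cart_abelian hH' hH1) (br0r L) add0r.
apply: eq_big_seq => a Pa.
by rewrite !(brZr, br_hX) // !scalerA /phi -mulrA mulrC (mulrC (ev a H)).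
Qed.

(** The bracket has weight $a+(-a)=0$, so by Jacobi it commutes with [h]; since [h] contains its
    normalizer, the bracket lies in [h]. The formula for [ev a] is invariance of the Killing
    form. *)
Let coroot a : a \in Phi ->
  {[ X a, X (- a) ]} \in h /\
  forall Y, Y \in h -> ev a Y = B Y {[ X a, X (- a) ]}.
Proof.
move=> Pa; split=> [|Y hY]; last first.
  by rewrite -(killing_br L) br_hX // (killingZl L) killing_XXN // eqxx mulr1.
have [_ _ norm] := cartP D; apply: norm => Y hY.
rewrite (brC L) memvN (br_derivation L) !(br_hX _ hY) ?root_opp //.
by rewrite evN (brZl L) (brZr L) scaleNr addrN mem0v.
Qed.

Lemma killing_nondegenerate H : H \in h -> (forall Y, Y \in h -> B Y H = 0) ->
  H = 0.
Proof.
move=> hH BH; apply: cart_center => // a Pa; have [hHa aE] := coroot Pa.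
by rewrite aE // killingC BH.
Qed.

(** The bracket meets the condition in the choice that defines [Hroot], and nondegeneracy on [h]
    leaves only one solution. *)
Lemma HrootE a : a \in Phi -> Hroot a = {[ X a, X (- a) ]}.
Proof.
move=> Pa; rewrite /Hroot; case: xgetP => [H -> [hH HE]|noH]; last first.
  by case: (noH {[ X a, X (- a) ]}); exact: coroot Pa.
have [hHa aE] := coroot Pa; apply/eqP; rewrite -subr_eq0; apply/eqP.
apply: killing_nondegenerate => [|Y hY]; first exact: memvB.
by rewrite (killingDr L) (killingNr L) -HE // -aE // subrr.
Qed.

Lemma Hroot_cart a : a \in Phi -> Hroot a \in h.
Proof. by move=> Pa; rewrite HrootE //; have [] := coroot Pa. Qed.

Lemma killing_Hroot a Y : a \in Phi -> Y \in h -> B Y (Hroot a) = ev a Y.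
Proof. by move=> Pa hY; rewrite HrootE //; have [_ ->] := coroot Pa. Qed.

Lemma ev_HrootC a b : a \in Phi -> b \in Phi ->
  ev b (Hroot a) = ev a (Hroot b).
Proof.
by move=> Pa Pb; rewrite -killing_Hroot ?Hroot_cart // killingC
  killing_Hroot ?Hroot_cart.
Qed.

Lemma nstr_eq0 a b : a \in Phi -> b \in Phi -> a + b \notin Phi -> n a b = 0.
Proof. by move=> Pa Pb; rewrite -(weyl_n0 W) // negbK => /eqP. Qed.

(** The two sides are $B([X_a,X_b],X_c)$ and $B(X_a,[X_b,X_c])$, because $a+b=-c$ and $b+c=-a$. *)
Lemma nstr_cyclic a b c : a \in Phi -> b \in Phi -> c \in Phi ->
  a + b + c = 0 -> n a b = n b c.
Proof.
move=> Pa Pb Pc abc.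
have abE : a + b = - c by apply/eqP; rewrite -addr_eq0 abc.
have bcE : b + c = - a by apply/eqP; rewrite -addr_eq0 addrC addrA abc.
apply: (@complexI R).
have := killing_br L (X a) (X b) (X c).
rewrite !(weyl_br W) ?abE ?bcE ?oppr_eq0 ?root_neq0 //.
rewrite (killingZl L) (killingZr L) (killingC _ (X (- c))) !killing_XXN //.
by rewrite !eqxx !mulr1.
Qed.

Lemma nstr_anti a b : a \in Phi -> b \in Phi -> a + b \in Phi ->
  n a b = - n b a.
Proof.
move=> Pa Pb Pab; have ab0 := root_neq0 Pab; apply: (@complexI R).
have ba0 : b + a != 0 by rewrite addrC.
have := brC L (X a) (X b); rewrite !(weyl_br W) // (addrC b a) -scaleNr -rmorphN.
move/(congr1 (fun x => B x (X (- (a + b))))); rewrite /= !(killingZl L).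
by rewrite killing_XXN // eqxx !mulr1.
Qed.

Lemma br_XN_br a b : a \in Phi -> b \in Phi -> a + b != 0 ->
  {[ X (- a), {[ X a, X b ]} ]} = (n a b ^+ 2)%:C *: X b.
Proof.
move=> Pa Pb ab0; rewrite (weyl_br W) // (brZr L).
have [Pab|nPab] := boolP (a + b \in Phi); last first.
  by rewrite nstr_eq0 // expr0n /= !scale0r.
have PNa := root_opp Pa; have PNb := root_opp Pb.
rewrite (weyl_br W) // ?addKr ?root_neq0 // scalerA -rmorphM /=.
(* The chain is $n(-a,a+b)=n(a+b,-b)=n(-b,-a)=-n(b,a)=n(a,b)$, with two cyclic shifts of the
   zero-sum triple $(-a,a+b,-b)$. *)
suff -> : n (- a) (a + b) = n a b by [].
rewrite (@nstr_cyclic _ _ (- b)) ?addKr ?subrr //.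
rewrite (@nstr_cyclic _ _ (- a)) ?addrK ?subrr //.
by rewrite (weyl_nN W) // !opprK -nstr_anti.
Qed.

(** Jacobi splits $[[X_a,X_{-a}],X_b]$ into $[X_a,[X_{-a},X_b]]-[X_{-a},[X_a,X_b]]$, and [br_XN_br]
    for $-a$ and for $a$ evaluates the two terms. *)
Lemma ev_Hroot a b : a \in Phi -> b \in Phi -> a != b -> a + b != 0 ->
  ev b (Hroot a) = (n (- a) b ^+ 2 - n a b ^+ 2)%:C.
Proof.
move=> Pa Pb ab ab0; have PNa := root_opp Pa.
have aNb : - a + b != 0 by rewrite addrC subr_eq0 eq_sym.
have : {[ Hroot a, X b ]} = (n (- a) b ^+ 2 - n a b ^+ 2)%:C *: X b.
  rewrite HrootE // rmorphB scalerBl -(br_XN_br Pa Pb ab0) -(br_XN_br PNa Pb aNb).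
  rewrite opprK.
  by rewrite [X in X - _](br_derivation L) addrK.
rewrite br_hX ?Hroot_cart //.
move/(congr1 (fun x => B x (X (- b)))); rewrite /= !(killingZl L).
by rewrite killing_XXN // eqxx !mulr1.
Qed.

(** * Reality and positivity on the real Cartan subalgebra *)

Lemma HrootN a : a \in Phi -> Hroot (- a) = - Hroot a.
Proof.
by move=> Pa; rewrite !HrootE ?root_opp // opprK (brC L).
Qed.

Lemma root_neq_opp a : a \in Phi -> a != - a.
Proof.
move=> /root_neq0; apply: contra => /eqP aN.
have : a + a == 0 by rewrite {2}aN subrr.
by rewrite -mulr2n -scaler_nat scaler_eq0 pnatr_eq0.
Qed.

(* Off the line of a, if c(H_a) <> 0 then a + c or c - a is a root, so a(H_a) is
   a difference of two real values; if there is no such c, then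
   a(H_a) = B(H_a, H_a) = 2 a(H_a)^2. *)
Lemma ev_Hroot_self_real a : a \in Phi -> ev a (Hroot a) \is Num.real.
Proof.
have off c d : c \in Phi -> d \in Phi -> d != c -> d != - c ->
    ev d (Hroot c) \is Num.real.
  move=> Pc Pd dc dNc; rewrite ev_Hroot ?complex_real //; first by rewrite eq_sym.
  by rewrite addrC addr_eq0.
have string e c : e \in Phi -> c \in Phi -> c != e -> c != - e -> n e c != 0 ->
    ev e (Hroot e) \is Num.real.
  move=> Pe Pc ce cNe; rewrite (weyl_n0 W) // => Pec.
  have ecr := off _ _ Pe Pc ce cNe.
  (* If $e+c=-e$, then $c=-2e$ and $c(H_e)=-2e(H_e)$ is already real. Otherwise $e(H_e)$ is the
     difference of the real values of $e+c$ and $c$. *)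
  have [ecE|ecNe] := eqVneq (e + c) (- e).
    have cE : c = - (e + e) by rewrite opprD -{1}ecE addrC addKr.
    move: ecr; rewrite cE evN evD -mulr2n realN -mulr_natr.
    by move/(rpred_div)/(_ (realn _ 2)); rewrite mulfK // pnatr_eq0.
  have ecne : e + c != e by rewrite -subr_eq0 addrC addKr root_neq0.
  have := off _ _ Pe Pec ecne ecNe.
  by rewrite evD => /rpredB/(_ ecr); rewrite addrK.
move=> Pa; have PNa := root_opp Pa; set t := ev a _.
have [/hasP[c Pc /and3P[ca cNa]]|/hasPn noc] := boolP (has (fun c =>
    [&& c != a, c != - a & ev c (Hroot a) != 0]) Phi).
  have ac : a != c by rewrite eq_sym.
  have ac0 : a + c != 0 by rewrite addrC addr_eq0.
  rewrite ev_Hroot //; have [nac|nac _] := eqVneq (n a c) 0; last first.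
    exact: string nac.
  have [->|nNac _] := eqVneq (n (- a) c) 0; first by rewrite nac subrr eqxx.
  have := @string (- a) c PNa Pc cNa; rewrite opprK => /(_ ca nNac).
  by rewrite HrootN // evN evNr opprK.
have tE : t = t * t + t * t.
  rewrite {1}/t -killing_Hroot ?Hroot_cart // killing_cart ?Hroot_cart //.
  rewrite (bigD1_seq a) ?roots_uniq //=; congr (_ + _).
  rewrite -big_filter (bigD1_seq (- a)) ?filter_uniq ?roots_uniq //=; last first.
    by rewrite mem_filter PNa eq_sym root_neq_opp.
  rewrite evN mulrNN -[RHS]addr0; congr (_ + _).
  rewrite big_filter_cond big_seq_cond big1 // => c /and3P[Pc ca cNa].
  have := noc c Pc; rewrite ca cNa /= negbK => /eqP ->.
  by rewrite mulr0.
have : t * (1 - 2 * t) == 0.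
  by rewrite mulrBr mulr1 mulrCA mulr2n mulrDl mul1r -tE subrr.
rewrite mulf_eq0 => /orP[/eqP -> //|]; rewrite subr_eq0 => /eqP t2.
have -> : t = 2^-1 by rewrite -[LHS](@mulKf _ 2) ?pnatr_eq0 // -t2 mulr1.
by rewrite realV realn.
Qed.

Lemma ev_Hroot_real a b : a \in Phi -> b \in Phi -> ev b (Hroot a) \is Num.real.
Proof.
move=> Pa Pb; have [->|ba] := eqVneq b a; first exact: ev_Hroot_self_real.
have [->|bNa] := eqVneq b (- a); first by rewrite evN realN ev_Hroot_self_real.
rewrite ev_Hroot ?complex_real //; first by rewrite eq_sym.
by rewrite addrC addr_eq0.
Qed.

(** Only the generators: [rspan real_cart] is $\mathfrak h_{\mathbb R}$. *)
Definition real_cart : seq g := [seq Hroot a | a <- Phi].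

Lemma real_cart_mem H : rspan real_cart H -> H \in h.
Proof.
move: H; apply: rspan_ind => [|k x y /mapP[a Pa ->] hy]; first exact: mem0v.
by rewrite memvD // memvZ // Hroot_cart.
Qed.

Lemma real_cart_ev H a : rspan real_cart H -> a \in Phi -> ev a H \is Num.real.
Proof.
move=> hH Pa; move: H hH.
apply: rspan_ind => [|k x y /mapP[b Pb ->] ya]; first by rewrite /ev !linear0 real0.
by rewrite evDr evZr realD ?realM ?complex_real ?ev_Hroot_real.
Qed.

Lemma real_cart_killing_ge0 H : rspan real_cart H -> 0 <= B H H.
Proof.
move=> rH; rewrite killing_cart ?real_cart_mem // big_seq sumr_ge0 // => a Pa.
by rewrite -expr2 real_exprn_even_ge0 // real_cart_ev.
Qed.

(** Roots are real here, so [killing_cart] is a sum of squares; if it is zero, every root vanishes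
    at [H] and [cart_center] applies. *)
Lemma real_cart_killing_eq0 H : rspan real_cart H -> B H H = 0 -> H = 0.
Proof.
move=> rH; have hH := real_cart_mem rH.
rewrite killing_cart // big_seq => /eqP; rewrite psumr_eq0; last first.
  by move=> a Pa; rewrite -expr2 real_exprn_even_ge0 // real_cart_ev.
move=> /allP aH; apply: cart_center => // a Pa.
by have := aH a Pa; rewrite Pa /= mulf_eq0 orbb => /eqP.
Qed.

Lemma real_cart_killing_real H H' :
  rspan real_cart H -> rspan real_cart H' -> B H H' \is Num.real.
Proof.
move=> rH rH'; rewrite killing_cart ?real_cart_mem // big_seq.
by apply: rpred_sum => a Pa; rewrite realM ?real_cart_ev.
Qed.

(** Orthogonal projection by Gram-Schmidt, one generator at a time; positive definiteness on the
    real span provides the nonzero denominators. *)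
Lemma real_cart_projection (s : seq g) v :
  (forall w, w \in s -> rspan real_cart w) -> rspan real_cart v ->
  exists2 y, rspan s y & forall w, w \in s -> B (v - y) w = 0.
Proof.
elim: s v => [|u s IHs] v rs rv; first by exists 0 => //; exact: rspan0.
have rs' w : w \in s -> rspan real_cart w.
  by move=> sw; apply: rs; rewrite inE sw orbT.
have ru : rspan real_cart u by apply: rs; rewrite mem_head.
have sus x : rspan s x -> rspan (u :: s) x.
  by apply: rspanS => z; rewrite inE orbC => ->.
have srs x : rspan s x -> rspan real_cart x.
  move: x; apply: rspan_ind => [|k x y /rs' rx ry]; first exact: rspan0.
  exact: rspan_linear.
have [yu syu uP] := IHs u rs' ru.
have [yv syv vP] := IHs v rs' rv.
set u' := u - yu in uP; set v' := v - yv in vP.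
have ru' : rspan real_cart u' by apply: rspanD => //; apply/rspanN/srs.
have rv' : rspan real_cart v' by apply: rspanD => //; apply/rspanN/srs.
have Bs x : (forall w, w \in s -> B x w = 0) -> forall y, rspan s y -> B x y = 0.
  move=> xs; apply: rspan_ind => [|k w y /xs xw xy]; first by rewrite killing0r.
  by rewrite (killingDr L) (killingZr L) xw xy mulr0 addr0.
(* The list need not be free: if [u] is already in the span of [s], orthogonality to [s] includes
   orthogonality to [u]. *)
have [u0|u'0] := eqVneq u' 0.
  exists yv; first exact: sus.
  move=> w; rewrite inE => /orP[/eqP ->|/vP //].
  by apply: (Bs _ vP); move/eqP: u0; rewrite subr_eq0 => /eqP ->.
have Bu0 : B u' u' != 0.
  by apply: contra u'0 => /eqP/(real_cart_killing_eq0 ru') ->.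
have /complex_realP[k kE] : B v' u' / B u' u' \is Num.real.
  by rewrite realM ?realV ?real_cart_killing_real.
exists (k%:C *: u' + yv).
  apply: rspan_linear; last exact: sus.
  by apply: rspanD; [apply: mem_rspan; rewrite mem_head | apply/rspanN/sus].
have -> : v - (k%:C *: u' + yv) = v' - k%:C *: u' by rewrite opprD addrCA addrC.
have orth w : w \in s -> B (v' - k%:C *: u') w = 0.
  move=> sw; rewrite (killingDl L) (killingNl L) (killingZl L) vP // uP //.
  by rewrite mulr0 subrr.
move=> w; rewrite inE => /orP[/eqP ->|]; last exact: orth.
have -> : u = u' + yu by rewrite subrK.
rewrite (killingDr L) (Bs _ orth _ syu) addr0 (killingDl L) (killingNl L).
by rewrite (killingZl L) -kE divfK // subrr.
Qed.

(** * Zero-sum triples of t-roots *)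

Lemma mem_R_Theta a : (a \in R_Theta D) = (a \in <<theta D>>%VS) && (a \in Phi).
Proof. by rewrite mem_filter. Qed.

Lemma mem_R_M a : (a \in R_M D) = (a \notin <<theta D>>%VS) && (a \in Phi).
Proof.
by rewrite mem_filter mem_R_Theta negb_and andb_orl andNb orbF.
Qed.

Lemma R_M_root a : a \in R_M D -> a \in Phi.
Proof. by rewrite mem_R_M => /andP[]. Qed.

Lemma R_Theta_root a : a \in R_Theta D -> a \in Phi.
Proof. by rewrite mem_R_Theta => /andP[]. Qed.

Lemma R_M_opp a : a \in R_M D -> - a \in R_M D.
Proof. by rewrite !mem_R_M memvN => /andP[-> /root_opp]. Qed.

Lemma R_M_addr a c : a \in R_M D -> c \in R_Theta D -> a + c \in Phi ->
  a + c \in R_M D.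
Proof.
rewrite !mem_R_M mem_R_Theta => /andP[aT _] /andP[cT _] ->; rewrite andbT.
by apply: contra aT => acT; rewrite -(addrK c a) memvB.
Qed.

Lemma kresD a b : kres (a + b) = kres a + kres b.
Proof. by apply/funext => H; exact: evD. Qed.

Lemma kresN a : kres (- a) = - kres a.
Proof. by apply/funext => H; exact: evN. Qed.

Lemma kres_R_Theta c : c \in R_Theta D -> kres c = 0.
Proof. by move=> Tc; apply/funext => -[H [rH HT]]; exact: HT. Qed.

(** Multiplication by ['i] carries these elements into [tspace]. Roots take real values on them, so
    that signs can be compared. *)
Definition real_center H := rspan real_cart H /\
  forall c, c \in R_Theta D -> ev c H = 0.

Lemma real_center_tspace H : real_center H -> tspace ('i%C *: H).
Proof.
move=> [rH HT]; split=> [|c Tc]; last by rewrite evZr HT // mulr0.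
move: H rH {HT}; apply: rspan_ind => [|k x y /mapP[a Pa ->] ry].
  by rewrite scaler0; exact: rspan0.
rewrite scalerDr scalerA mulrC -scalerA; apply: rspan_linear => //.
by apply: mem_rspan; apply: map_f.
Qed.

Lemma real_center_kres H a b : real_center H -> kres a = kres b ->
  ev a H = ev b H.
Proof.
move=> /real_center_tspace tH /(congr1 (fun f => f (exist _ _ tH))).
rewrite /kres /= !evZr => /mulfI; apply.
by rewrite eq_complex /= oner_eq0 andbF.
Qed.

(** [H] is $H_a$ minus its projection [y] to the real span of the $H_c$, $c\in R_\Theta$. If
    $a(H)=0$, then $B(H,H)=0$ and $H_a=y$, which would put $a$ in the span of [theta]. *)
Lemma R_M_separated a : a \in R_M D -> exists2 H, real_center H & ev a H != 0.
Proof.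
rewrite mem_R_M => /andP[aT Pa].
pose s := [seq Hroot c | c <- R_Theta D].
have rs w : w \in s -> rspan real_cart w.
  by move=> /mapP[c /R_Theta_root Pc ->]; apply: mem_rspan; apply: map_f.
have ra : rspan real_cart (Hroot a) by apply: mem_rspan; apply: map_f.
have [y sy yP] := real_cart_projection rs ra.
have ry : rspan real_cart y.
  move: y sy {yP}; apply: rspan_ind => [|k x y /rs rx ry]; first exact: rspan0.
  exact: rspan_linear.
have rH : rspan real_cart (Hroot a - y) by apply: rspanD => //; exact: rspanN.
have hH := real_cart_mem rH.
exists (Hroot a - y).
  split=> // c Tc; rewrite -killing_Hroot ?R_Theta_root // yP //.
  exact: map_f.
apply: contra aT; rewrite -killing_Hroot // => /eqP Ba0.
have By0 : B (Hroot a - y) y = 0.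
  move: {-2}y sy; apply: rspan_ind => [|k w z /yP yw yz]; first by rewrite killing0r.
  by rewrite (killingDr L) (killingZr L) yw yz mulr0 addr0.
have /eqP : Hroot a - y = 0.
  apply: real_cart_killing_eq0 => //.
  by rewrite (killingDr L) (killingNr L) Ba0 By0 subrr.
rewrite subr_eq0 => /eqP aE.
(* [b] is the functional that [y] represents through the Killing form. *)
have [b bT bE] : exists2 b, b \in <<theta D>>%VS &
    forall Y, Y \in h -> B Y y = ev b Y.
  move: y sy {yP ry rH hH Ba0 By0 aE}.
  apply: rspan_ind => [|k _ z /mapP[c Tc ->] [b bT bE]].
    by exists 0 => [|Y hY]; rewrite ?mem0v // killing0r // ev0.
  exists (k%:C *: c + b) => [|Y hY].
    by rewrite memvD // memvZ //; move: Tc; rewrite mem_R_Theta => /andP[].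
  rewrite (killingDr L) (killingZr L) bE // killing_Hroot ?R_Theta_root //.
  by rewrite evD evZ.
suff -> : a = b by [].
by apply: dual_eqP => Y hY; rewrite -killing_Hroot // aE bE.
Qed.

Lemma kres_neq0 a : a \in R_M D -> kres a != 0.
Proof.
move=> Ma; have [H cH] := R_M_separated Ma; apply: contra => /eqP a0.
by rewrite (@real_center_kres _ _ 0) ?ev0 // a0; apply/esym/funext => K; exact: ev0.
Qed.

(* The trace of H_c on the span of the root vectors X_a, a in S, computed as
   the trace of the commutator of X_c and X_(-c). *)
Lemma sum_ev_Hroot_eq0 (S : seq (dual h)) c : uniq S -> {subset S <= Phi} ->
  c \in Phi -> c \notin S -> - c \notin S ->
  (forall a, a \in S -> a + c \in Phi -> a + c \in S) ->
  (forall a, a \in S -> a - c \in Phi -> a - c \in S) ->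
  \sum_(a <- S) ev a (Hroot c) = 0.
Proof.
move=> uS SP Pc cS NcS addS subS; have PNc := root_opp Pc.
have nE d : d \in Phi -> forall a, a \in S -> d + a \notin S ->
    (forall a, a \in S -> a + d \in Phi -> a + d \in S) -> n d a = 0.
  move=> Pd a Sa; rewrite addrC => adS dS; apply: nstr_eq0 => //; first exact: SP.
  by rewrite addrC; apply: contra adS => /dS; apply.
(* A constant whose shifted root leaves [S] is zero by [nE], so the squares from [ev_Hroot] may be
   restricted to shifts that stay in [S]. *)
have -> : \sum_(a <- S) ev a (Hroot c) =
    (\sum_(a <- S | - c + a \in S) n (- c) a ^+ 2)%:C -
    (\sum_(a <- S | c + a \in S) n c a ^+ 2)%:C.
  rewrite -rmorphB /=.
  rewrite [in X in _ = (X - _)%:C]big_mkcond [in X in _ = (_ - X)%:C]big_mkcond.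
  rewrite -sumrB rmorph_sum /=; apply: eq_big_seq => a Sa.
  have ca : c != a by apply: contra cS => /eqP ->.
  have ca0 : c + a != 0 by apply: contra NcS; rewrite addrC addr_eq0 => /eqP <-.
  rewrite ev_Hroot ?(SP a) //; congr (_ - _)%:C.
    by case: ifPn => // nS; rewrite (nE (- c)) ?expr0n.
  by case: ifPn => // nS; rewrite (nE c) ?expr0n.
apply/eqP; rewrite subr_eq0; apply/eqP; congr (_%:C).
rewrite -big_filter -[RHS]big_filter.
(* Since $n(c,a)^2=n(-c,c+a)^2$, the shift $a\mapsto c+a$ matches the two sums term by term. *)
have -> : \sum_(a <- [seq a <- S | c + a \in S]) n c a ^+ 2 =
    \sum_(a <- [seq c + a | a <- [seq a <- S | c + a \in S]]) n (- c) a ^+ 2.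
  rewrite big_map; apply: eq_big_seq => a; rewrite mem_filter => /andP[caS aS].
  have Pa := SP _ aS; have Pca := SP _ caS.
  have PNa := root_opp Pa.
  rewrite (@nstr_cyclic (- c) (c + a) (- a)) ?addKr ?subrr //.
  rewrite (@nstr_cyclic (c + a) (- a) (- c)) ?addrK ?subrr //.
  by rewrite (weyl_nN W PNa PNc) !opprK sqrrN (nstr_anti Pc Pa Pca) sqrrN.
apply: perm_big; apply: uniq_perm.
- exact: filter_uniq.
- by rewrite map_inj_uniq ?filter_uniq //; exact: addrI.
move=> a; rewrite mem_filter; apply/andP/mapP => [[caS aS]|[b]].
  by exists (- c + a); rewrite ?addNKr // mem_filter addNKr aS.
by rewrite mem_filter => /andP[cbS bS] ->; rewrite addKr.
Qed.

(** * Fibres of the restriction map and lifting of sums *)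

Definition fiber (d : tdual D) := [seq a <- R_M D | `[< kres a = d >]].

Lemma mem_fiber d a : a \in fiber d <-> a \in R_M D /\ kres a = d.
Proof.
rewrite mem_filter; split=> [/andP[/asboolP ad ->] //|[-> ad]].
by rewrite andbT; apply/asboolP.
Qed.

Definition fiber_sum (d : tdual D) : g := \sum_(a <- fiber d) Hroot a.

Lemma fiber_sum_real_center d : real_center (fiber_sum d).
Proof.
split=> [|c Tc].
  rewrite /fiber_sum big_seq; apply: rspan_sum => a /mem_fiber[/R_M_root Pa _].
  by apply: mem_rspan; apply: map_f.
have Pc := R_Theta_root Tc.
have cNM b : b \in <<theta D>>%VS -> b \notin fiber d.
  by move=> bT; apply/negP => /mem_fiber[]; rewrite mem_R_M bT.
have cT : c \in <<theta D>>%VS by move: Tc; rewrite mem_R_Theta => /andP[].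
rewrite ev_sumr -[RHS](@sum_ev_Hroot_eq0 (fiber d) c) //.
- by apply: eq_big_seq => a /mem_fiber[/R_M_root Pa _]; rewrite ev_HrootC.
- by rewrite !filter_uniq // roots_uniq.
- by move=> a /mem_fiber[/R_M_root].
- exact: cNM.
- by rewrite cNM // memvN.
- move=> a /mem_fiber[Ma ka] Pac; apply/mem_fiber.
  by rewrite R_M_addr // kresD (kres_R_Theta Tc) addr0.
move=> a /mem_fiber[Ma ka] Pac; apply/mem_fiber.
have TNc : - c \in R_Theta D by rewrite mem_R_Theta memvN cT root_opp.
by rewrite R_M_addr // kresD (kres_R_Theta TNc) addr0.
Qed.

(** With $N$ the size of the fibre, $B(H,A)=N\,a(H)$ for [H] in the real center. Taking $H=A$ gives
    $N\,a(A)=B(A,A)$, and $A\neq 0$ because some such [H] has $a(H)\neq 0$. *)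
Lemma fiber_sum_gt0 a : a \in R_M D -> 0 < ev a (fiber_sum (kres a)).
Proof.
move=> Ma; set A := fiber_sum _.
have cA : real_center A by exact: fiber_sum_real_center.
have BA H : real_center H -> B H A = (size (fiber (kres a)))%:R * ev a H.
  move=> cH; rewrite /A /fiber_sum (killing_sumr L).
  rewrite mulr_natl -count_predT -[RHS]addr0 -iter_addr -big_const_seq.
  apply: eq_big_seq => b /mem_fiber[Mb kb].
  rewrite killing_Hroot ?R_M_root //; last by apply: real_cart_mem; case: cH.
  exact: real_center_kres.
have a_fib : a \in fiber (kres a) by apply/mem_fiber.
have N0 : (0 < (size (fiber (kres a)))%:R :> C).
  by rewrite ltr0n; case: (fiber _) a_fib.
have [rA _] := cA.
rewrite -(pmulr_rgt0 _ N0) -BA // lt_def real_cart_killing_ge0 // andbT.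
apply/eqP => /(real_cart_killing_eq0 rA) A0.
have [H cH /eqP] := R_M_separated Ma; apply.
by apply/eqP; rewrite -(mulrI_eq0 _ (mulfI (lt0r_neq0 N0))) -BA // A0 killing0r.
Qed.

Lemma kres_add_lift a b c : a \in R_M D -> b \in R_M D -> c \in R_M D ->
  kres a + kres b = kres c -> exists a' b',
  [/\ a' \in R_M D, b' \in R_M D, a' + b' \in R_M D,
      kres a' = kres a & kres b' = kres b].
Proof.
move=> Ma Mb Mc abc.
have Mk d : d \in Phi -> kres d != 0 -> d \in R_M D.
  move=> Pd; rewrite /R_M mem_filter Pd andbT; apply: contra => /kres_R_Theta ->.
  exact: eqxx.
set A := fiber_sum (kres a).
have cA : real_center A by exact: fiber_sum_real_center.
have Hself d : d \in Phi -> 0 <= ev d (Hroot d).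
  move=> Pd; rewrite -killing_Hroot ?Hroot_cart //.
  by apply: real_cart_killing_ge0; apply: mem_rspan; apply: map_f.
have Pb := R_M_root Mb; have Pc := R_M_root Mc.
have [/hasP[a' fa' ba']|/hasPn nonneg] :=
    boolP (has (fun a' => ev b (Hroot a') < 0) (fiber (kres a))).
  have [Ma' ka'] := (mem_fiber _ _).1 fa'; have Pa' := R_M_root Ma'.
  exists a', b; split=> //; apply: Mk; last by rewrite kresD ka' abc kres_neq0.
  (* Were $n(a',b)$ zero, $b(H_{a'})$ would be a square. Of the cases outside [ev_Hroot], $a'=b$
     gives a nonnegative value and $a'=-b$ would make [kres c] zero. *)
  rewrite -(weyl_n0 W) //; apply: contraTneq ba' => nab.
  rewrite -real_leNgt ?real0 ?ev_Hroot_real //.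
  have [<-|a'b] := eqVneq a' b; first exact: Hself.
  rewrite ev_Hroot //.
    by rewrite nab expr0n subr0 ler0c sqr_ge0.
  apply: contraNneq (kres_neq0 Mc) => a'b0; rewrite -abc -ka' -kresD a'b0.
  by apply/eqP/funext => K; exact: ev0.
have bA : 0 <= ev b A.
  rewrite ev_sumr big_seq sumr_ge0 // => a' fa'.
  have [Ma' _] := (mem_fiber _ _).1 fa'.
  by rewrite real_leNgt ?real0 ?ev_Hroot_real ?R_M_root ?nonneg.
have cA0 : 0 < ev c A.
  by rewrite (@real_center_kres _ _ (a + b)) ?kresD // evD ltr_pwDl ?fiber_sum_gt0.
have /hasP[a' fa' ca'] : has (fun a' => 0 < ev c (Hroot a')) (fiber (kres a)).
  apply: contraTT cA0 => /hasPn nonpos.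
  rewrite -real_leNgt ?real0 ?real_cart_ev //; last by case: cA.
  rewrite ev_sumr big_seq -oppr_ge0 -sumrN sumr_ge0 // => a' fa'.
  have [Ma' _] := (mem_fiber _ _).1 fa'.
  by rewrite oppr_ge0 real_leNgt ?real0 ?ev_Hroot_real ?R_M_root ?nonpos.
have [Ma' ka'] := (mem_fiber _ _).1 fa'; have Pa' := R_M_root Ma'.
have kb : kres (- a' + c) = kres b by rewrite kresD kresN ka' -abc addKr.
(* The positive product makes $c-a'$ a root; it lies over [kres b], and adding $a'$ returns [c]. *)
exists a', (- a' + c); rewrite addNKr; split=> //.
apply: Mk; last by rewrite kb kres_neq0.
rewrite -(weyl_n0 W) ?root_opp //; apply: contraTneq ca' => nac.
rewrite -real_leNgt ?real0 ?ev_Hroot_real //.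
have [cE|a'c] := eqVneq a' c.
  have := kres_neq0 Mb; rewrite -kb cE addNr => /eqP; case.
  by apply/funext => K; exact: ev0.
have [a'c0|a'c0] := eqVneq (a' + c) 0.
  have -> : c = - a' by apply/eqP; rewrite -addr_eq0 addrC a'c0.
  by rewrite evN oppr_le0 Hself.
by rewrite ev_Hroot // nac expr0n sub0r rmorphN oppr_le0 ler0c sqr_ge0.
Qed.

(** * The real tangent space *)

Local Notation m := (@mspace R D).

Lemma mem_u_gens (s : seq (dual h)) x :
  reflect (exists2 a, a \in s & x = X a - X (- a) \/ x = 'i%C *: (X a + X (- a)))
    (x \in u_gens s).
Proof.
apply: (iffP flatten_mapP) => -[a sa]; rewrite ?inE => xE; exists a => //.
  by case/orP: xE => /eqP ->; [left | right].
by rewrite !inE; case: xE => ->; rewrite eqxx ?orbT.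
Qed.

Lemma mem_R_M_pos a : a \in R_M D -> (a \in R_M_pos D) || (- a \in R_M_pos D).
Proof.
move=> Ma; rewrite /R_M_pos (mem_filter _ a) (mem_filter _ (- a)).
rewrite Ma R_M_opp // !andbT.
have [_ _ /(_ a (R_M_root Ma))] := simpP D.
by case=> ?; apply/orP; [left | right]; apply/asboolP.
Qed.

Lemma R_M_posW a : a \in R_M_pos D -> a \in R_M D.
Proof. by rewrite mem_filter => /andP[]. Qed.

(** Summands are indexed by positive t-roots only. For negative [a] the generators of $-a$ serve, as
    they agree with those of [a] up to sign. *)
Lemma mspace_at_gens a : a \in R_M D -> exists d, [/\ R_t_pos d,
  d = kres a \/ d = - kres a,
  mspace_at d (X a - X (- a)) & mspace_at d ('i%C *: (X a + X (- a)))].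
Proof.
move=> Ma.
have gens c : c \in R_M_pos D -> mspace_at (kres c) (X c - X (- c)) /\
    mspace_at (kres c) ('i%C *: (X c + X (- c))).
  move=> Mc; split; apply: mem_rspan; apply/mem_u_gens; exists c; auto;
    by rewrite mem_filter Mc andbT; apply/asboolP.
case/orP: (mem_R_M_pos Ma) => Mpos.
  by exists (kres a); split; [exists a | left | case: (gens a) | case: (gens a)].
exists (- kres a); have [] := gens _ Mpos; rewrite kresN opprK => Aa Sa; split=> //.
- by exists (- a); rewrite ?kresN.
- by right.
- by rewrite -opprB; apply: rspanN.
- by rewrite addrC.
Qed.

Lemma mspace_gens a : a \in R_M D ->
  m (X a - X (- a)) /\ m ('i%C *: (X a + X (- a))).
Proof.
move=> Ma; have sub d : {subset u_gens [seq c <- R_M_pos D | `[< kres c = d >]]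
    <= u_gens (R_M_pos D)}.
  move=> x /mem_u_gens[c]; rewrite mem_filter => /andP[_ Mc] xE.
  by apply/mem_u_gens; exists c.
by have [d [_ _ Aa Sa]] := mspace_at_gens Ma; split; apply: rspanS (sub d) _.
Qed.

(** This is the splitting of [X a] along the real form and ['i] times it; [- 2^-1] cancels the sign
    of the square of ['i]. *)
Lemma weyl_vector_parts a :
  X a = (2^-1)%:C *: (X a - X (- a))
        + 'i%C *: ((- 2^-1)%:C *: ('i%C *: (X a + X (- a)))).
Proof.
have i2 : 'i%C * (- 2^-1)%:C * 'i%C = (2^-1)%:C :> C.
  by rewrite mulrAC -expr2 sqr_i mulN1r rmorphN opprK.
rewrite !scalerA i2 -scalerDr addrACA addNr addr0 -mulr2n -scaler_nat scalerA.
rewrite -(rmorph_nat (real_complex R)) -rmorphM /= mulVf ?pnatr_eq0 //.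
by rewrite rmorph1 scale1r.
Qed.

Lemma mspace_weyl_parts a : a \in R_M D ->
  m ((2^-1)%:C *: (X a - X (- a))) /\
  m ((- 2^-1)%:C *: ('i%C *: (X a + X (- a)))).
Proof. by case/mspace_gens => *; split; exact: rspanZ. Qed.

Lemma mspaceB x y : m x -> m y -> m (x - y).
Proof. by move=> mx my; exact: (rspanD mx (rspanN my)). Qed.

Lemma mspace_mC x : m x -> x \in mC D.
Proof.
move: x; apply: rspan_ind => [|k x y sx]; first exact: mem0v.
by apply: memvD; rewrite memvZ // memv_span.
Qed.

Lemma weyl_mem_mC a : a \in R_M D -> X a \in mC D.
Proof.
move=> /mspace_weyl_parts[Aa Sa].
by rewrite weyl_vector_parts memvD ?(mspace_mC Aa) // memvZ ?(mspace_mC Sa).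
Qed.

Lemma mC_coordinates z : z \in mC D ->
  z = \sum_(a <- R_M D) B z (X (- a)) *: X a.
Proof.
move: z; apply: span_ind => [|k x y /mem_u_gens[b /R_M_posW Mb xE] yE].
  by rewrite big1 // => a _; rewrite killing0l // scale0r.
have XE c : c \in R_M D -> X c = \sum_(a <- R_M D) B (X c) (X (- a)) *: X a.
  move=> Mc; rewrite (bigD1_seq c) ?filter_uniq ?roots_uniq //=.
  rewrite killing_XXN ?R_M_root // eqxx scale1r big_seq_cond big1 ?addr0 //.
  move=> a /andP[Ma ac]; rewrite killing_XXN ?R_M_root // eq_sym (negPf ac).
  exact: scale0r.
(* [T] is linear and fixes each [X c] with [c] in [R_M], hence every generator of [mC]. *)
pose T z : g := \sum_(a <- R_M D) B z (X (- a)) *: X a.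
have TD (l : C) u v : T (l *: u + v) = l *: T u + T v.
  rewrite /T scaler_sumr -big_split; apply: eq_bigr => a _ /=.
  by rewrite (killingDl L) (killingZl L) scalerDl scalerA.
rewrite -/(T _) TD -[T y]yE; congr (_ *: _ + _).
have MNb := R_M_opp Mb.
case: xE => ->.
  by rewrite addrC -scaleN1r TD -/(T _) -[T (X b)]XE // -[T (X (- b))]XE.
have -> : 'i%C *: (X b + X (- b)) = 'i%C *: X b + ('i%C *: X (- b) + 0).
  by rewrite scalerDr addr0.
have T0 : T 0 = 0 by rewrite /T big1 // => a _; rewrite killing0l // scale0r.
by rewrite !TD T0 -[T (X b)]XE // -[T (X (- b))]XE.
Qed.

(* The real form is fixed by the conjugation X_a |-> - X_(-a). *)
Lemma mspace_conj x a : m x -> a \in R_M D -> B x (X a) = - (B x (X (- a)))^*%C.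
Proof.
move=> mx Ma; move: x mx; have Pa := R_M_root Ma; have PNa := root_opp Pa.
apply: rspan_ind => [|k x y /mem_u_gens[b /R_M_posW/R_M_root Pb xE] yE].
  by rewrite !killing0l // rmorph0 oppr0.
rewrite !(killingDl L) !(killingZl L) conjcD conjcM conjc_real opprD -yE.
rewrite -mulrN; congr (_ * _ + _).
have PNb := root_opp Pb.
have Bba : B (X b) (X a) = (b == - a)%:R by rewrite -{1}(opprK a) killing_XXN.
have BNba : B (X (- b)) (X a) = (b == a)%:R.
  by rewrite -{1}(opprK a) killing_XXN // eqr_opp.
case: xE => ->.
  rewrite !(killingDl L) !(killingNl L) Bba BNba !killing_XXN //.
  by rewrite conjcB !conjc_nat opprB eqr_oppLR.
rewrite !(killingZl L) !(killingDl L) Bba BNba !killing_XXN // eqr_oppLR.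
rewrite conjcM conjcD conjc_i !conjc_nat.
by rewrite mulNr opprK addrC.
Qed.

(** The conjugation rule holds for both [x] and [y], but conjugating ['i] changes a sign; each
    coordinate of [y] is thus its own negative. This makes [cparts] unambiguous. *)
Lemma mspace_capi x y : m x -> m y -> x = 'i%C *: y -> y = 0.
Proof.
move=> mx my xy; rewrite (mC_coordinates (mspace_mC my)) big_seq big1 // => a Ma.
suff -> : B y (X (- a)) = 0 by rewrite scale0r.
have MNa := R_M_opp Ma.
have := mspace_conj mx MNa; rewrite xy !(killingZl L) conjcM conjc_i.
rewrite mulNr opprK -[X in _ = _ * X]opprK -mspace_conj // mulrN => /eqP.
rewrite -addr_eq0 -mulrDr mulf_eq0 eq_complex /= oner_eq0 andbF /=.
by rewrite -mulr2n -mulr_natr mulf_eq0 pnatr_eq0 orbF => /eqP.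
Qed.

Lemma cpartsE x y : m x -> m y -> cparts m (x + 'i%C *: y) = (x, y).
Proof.
move=> mx my; rewrite /cparts; set P := (X in xget _ X).
have /(xgetPex (0, 0)) : exists p, P p by exists (x, y).
case: (xget _ _) => x' y' [/= mx' my' xyE].
have yy' : y - y' = 0.
  apply: (mspace_capi (mspaceB mx' mx) (mspaceB my my')); rewrite scalerBr.
  by apply/eqP; rewrite subr_eq addrAC eq_sym subr_eq addrC xyE.
by move/eqP: yy' xyE; rewrite subr_eq0 => /eqP <- /addIr <-.
Qed.

Lemma mC_parts z : z \in mC D -> exists x y, [/\ m x, m y & z = x + 'i%C *: y].
Proof.
move: z; apply: span_ind => [|k u v su [x [y [mx my ->]]]].
  by exists 0, 0; rewrite scaler0 addr0; split=> //; exact: rspan0.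
have mu : m u by exact: mem_rspan.
case: k => p q; exists (p%:C *: u + x), (q%:C *: u + y).
split; [exact: rspan_linear..|].
rewrite scalerDr addrACA scalerA -scalerDl; congr (_ *: _ + _).
by rewrite [LHS]complexE.
Qed.

(** * Almost Hermitian structures *)

Variables (J : g -> g) (gm : g -> g -> R) (eps lam : tdual D -> R).
Hypotheses (HJ : invariant_acs J) (Heps : acs_signs J eps).
Hypotheses (Hg : invariant_metric gm) (Hlam : metric_coefs gm lam).

(** Linearity is restricted to [mC] because [cparts] returns a default pair off the complexified
    tangent space. *)
Definition linear_on_mC (V : lmodType C) (f : g -> V) := forall (k : C) x y,
  x \in mC D -> y \in mC D -> f (k *: x + y) = k *: f x + f y.

Lemma linear_on_mC0 (V : lmodType C) (f : g -> V) : linear_on_mC f -> f 0 = 0.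
Proof.
move=> flin; apply: (addrI (f 0)); have := flin 1 0 0 (mem0v _) (mem0v _).
by rewrite !scale1r !addr0 => <-.
Qed.

Lemma linear_on_mCZ (V : lmodType C) (f : g -> V) (k : C) x :
  linear_on_mC f -> x \in mC D -> f (k *: x) = k *: f x.
Proof.
move=> flin mx; have := flin k x 0 mx (mem0v _).
by rewrite (linear_on_mC0 flin) !addr0.
Qed.

Lemma linear_on_mC_sum (V : lmodType C) (f : g -> V) (s : seq (dual h))
    (z : dual h -> C) : linear_on_mC f -> {subset s <= R_M D} ->
  f (\sum_(a <- s) z a *: X a) = \sum_(a <- s) z a *: f (X a).
Proof.
move=> flin; have f0 := linear_on_mC0 flin.
elim: s => [|a s IHs] sM; first by rewrite !big_nil f0.
have sM' : {subset s <= R_M D} by move=> c sc; apply: sM; rewrite inE sc orbT.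
rewrite !big_cons flin ?IHs ?weyl_mem_mC ?sM ?mem_head //.
rewrite big_seq; apply: memv_suml => c sc.
by rewrite memvZ // weyl_mem_mC ?sM'.
Qed.

Lemma complex_linear_on_mC (V : lmodType C) (f : g -> V) (f1 : g -> V) :
  (forall x y, m x -> m y -> f (x + 'i%C *: y) = f1 x + 'i%C *: f1 y) ->
  (forall (k : R) x y, m x -> m y -> f1 (k%:C *: x + y) = k%:C *: f1 x + f1 y) ->
  linear_on_mC f.
Proof.
move=> fE f1lin [p q] z w /mC_parts[x [y [mx my ->]]] /mC_parts[x' [y' [mx' my' ->]]].
have kE (U : lmodType C) (u v u' v' : U) :
    (p +i* q)%C *: (u + 'i%C *: v) + (u' + 'i%C *: v') =
    (p%:C *: u + ((- q)%:C *: v + u')) + 'i%C *: (p%:C *: v + (q%:C *: u + v')).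
  rewrite [(p +i* q)%C]complexE /= !scalerDr !scalerDl !scalerA.
  have -> : 'i%C * q%:C * 'i%C = (- q)%:C :> C.
    by rewrite mulrAC -expr2 sqr_i mulN1r rmorphN.
  rewrite (mulrC p%:C) -!addrA; congr (_ + _).
  rewrite [RHS]addrC -!addrA addrC -!addrA.
  rewrite [RHS]addrCA; congr (_ + _); rewrite addrCA; congr (_ + _).
  by rewrite addrCA [RHS]addrC -addrA.
have lin (k : R) u v : m u -> m v -> m (k%:C *: u + v) by exact: rspan_linear.
have mq := lin (- q) _ _ my mx'; have mq' := lin q _ _ mx my'.
rewrite kE (fE _ _ (lin p _ _ mx mq) (lin p _ _ my mq')) (fE _ _ mx my).
by rewrite (fE _ _ mx' my') kE (f1lin _ _ _ mx mq) (f1lin _ _ _ my mq') !f1lin.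
Qed.

Lemma JC_parts x y : m x -> m y -> JC J (x + 'i%C *: y) = J x + 'i%C *: J y.
Proof. by move=> mx my; rewrite /JC /clinear_ext cpartsE. Qed.

Lemma JC_linear : linear_on_mC (JC J).
Proof.
apply: (complex_linear_on_mC JC_parts) => k x y mx my.
exact: (acs_linear HJ).
Qed.

Definition real_bilinear_on_m (b : g -> g -> R) :=
  (forall (k : R) x y z, m x -> m y -> m z ->
    b (k%:C *: x + y) z = k * b x z + b y z) /\
  (forall (k : R) x y z, m x -> m y -> m z ->
    b z (k%:C *: x + y) = k * b z x + b z y).

(** The nested form exhibits the extension as $f_1(x)+i f_1(y)$, as [complex_linear_on_mC]
    requires. *)
Lemma cbilinear_ext_parts (b : g -> g -> R) x y x' y' :
  m x -> m y -> m x' -> m y' ->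
  cbilinear_ext m b (x + 'i%C *: y) (x' + 'i%C *: y') =
  (b x x')%:C + 'i%C * (b x y')%:C + 'i%C * ((b y x')%:C + 'i%C * (b y y')%:C).
Proof.
move=> mx my mx' my'; rewrite /cbilinear_ext !cpartsE //.
rewrite [LHS]complexE /= rmorphB rmorphD !mulrDr (mulrA 'i%C 'i%C) -expr2 sqr_i.
by rewrite mulN1r addrACA (addrC (- _)).
Qed.

Lemma cbilinear_ext_linearl (b : g -> g -> R) w : real_bilinear_on_m b ->
  w \in mC D -> linear_on_mC (fun z => cbilinear_ext m b z w : C^o).
Proof.
move=> [bl _] /mC_parts[x' [y' [mx' my' ->]]].
apply: (@complex_linear_on_mC _ _
  (fun x => (b x x')%:C + 'i%C * (b x y')%:C)).
  by move=> x y mx my; rewrite cbilinear_ext_parts.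
move=> k x y mx my; rewrite !bl // !rmorphD !rmorphM /= scalerDr mulrDr addrACA.
by rewrite mulrCA.
Qed.

Lemma cbilinear_ext_linearr (b : g -> g -> R) z : real_bilinear_on_m b ->
  z \in mC D -> linear_on_mC (fun w => cbilinear_ext m b z w : C^o).
Proof.
move=> [_ br] /mC_parts[x [y [mx my ->]]].
apply: (@complex_linear_on_mC _ _
  (fun x' => (b x x')%:C + 'i%C * (b y x')%:C)).
  move=> x' y' mx' my'; rewrite cbilinear_ext_parts // mulrDr addrACA.
  by rewrite -mulrDr.
move=> k x' y' mx' my'; rewrite !br // !rmorphD !rmorphM /= scalerDr mulrDr addrACA.
by rewrite mulrCA.
Qed.

(** * The metric and the Kähler form on root vectors *)

Lemma metric_bilinear : real_bilinear_on_m gm.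
Proof.
split=> k x y z mx my mz; first exact: (metric_linear Hg).
rewrite !(metric_sym Hg mz) ?(metric_linear Hg) //.
exact: rspan_linear.
Qed.

Lemma metric_acs_bilinear : real_bilinear_on_m (fun x y => gm x (J y)).
Proof.
have [gl gr] := metric_bilinear.
split=> k x y z mx my mz; first by apply: gl => //; exact: (acs_m HJ).
by rewrite (acs_linear HJ) // gr //; exact: (acs_m HJ).
Qed.

Lemma OmegaC_linearl w : w \in mC D ->
  linear_on_mC (fun z => OmegaC J gm z w : C^o).
Proof. exact: cbilinear_ext_linearl metric_acs_bilinear. Qed.

Lemma OmegaC_linearr z : z \in mC D ->
  linear_on_mC (fun w => OmegaC J gm z w : C^o).
Proof. exact: cbilinear_ext_linearr metric_acs_bilinear. Qed.

Lemma OmegaC_JC z w : z \in mC D -> w \in mC D ->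
  OmegaC J gm z w = cbilinear_ext m gm z (JC J w).
Proof.
move=> /mC_parts[x [y [mx my ->]]] /mC_parts[x' [y' [mx' my' ->]]].
rewrite JC_parts // [LHS]cbilinear_ext_parts // cbilinear_ext_parts //.
  exact: (acs_m HJ).
exact: (acs_m HJ).
Qed.

Lemma metric_gens a b x y : a \in R_M D -> b \in R_M D ->
  x = X a - X (- a) \/ x = 'i%C *: (X a + X (- a)) ->
  y = X b - X (- b) \/ y = 'i%C *: (X b + X (- b)) ->
  (gm x y)%:C = - ((lam (kres a))%:C * B x y).
Proof.
move=> Ma Mb xE yE.
have [d [td dE dA dS]] := mspace_at_gens Ma.
have dx : mspace_at d x by case: xE => ->.
have ta : R_t (kres a) by exists a.
have diag : mspace_at d y -> (gm x y)%:C = - ((lam (kres a))%:C * B x y).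
  move=> dy; rewrite (lam_diag Hlam td dx dy).
  by case: dE => ->; rewrite ?(lam_opp Hlam).
(* For $b=\pm a$ both vectors lie in one summand. Otherwise all pairings of $X_{\pm a}$ with $X_{\pm
   b}$ vanish, which settles the case of distinct summands. *)
have [ba|ba] := eqVneq b a.
  by apply: diag; case: yE => ->; rewrite ba.
have [bNa|bNa] := eqVneq b (- a).
  apply: diag; case: yE => ->; rewrite bNa opprK; last by rewrite addrC.
  by rewrite -opprB; exact: rspanN.
have [e [te _ eA eS]] := mspace_at_gens Mb.
have ey : mspace_at e y by case: yE => ->.
have [de|de] := EM (d = e); first by apply: diag; rewrite de.
rewrite (lam_orth Hlam td te de dx ey).
suff -> : B x y = 0 by rewrite mulr0 oppr0.
have [Pa Pb] := (R_M_root Ma, R_M_root Mb).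
have [PNa PNb] := (root_opp Pa, root_opp Pb).
have ab0 : B (X a) (X b) = 0 by rewrite killing_XX_eq0 // addrC addr_eq0.
have aNb0 : B (X a) (X (- b)) = 0 by rewrite killing_XXN // eq_sym (negPf ba).
have Nab0 : B (X (- a)) (X b) = 0.
  by rewrite killing_XX_eq0 // addrC subr_eq0.
have NaNb0 : B (X (- a)) (X (- b)) = 0.
  by rewrite killing_XXN // eq_sym (negPf bNa).
case: xE => ->; case: yE => ->; rewrite ?(killingZl L) ?(killingZr L)
    !(killingDl L) !(killingDr L);
  by rewrite ?(killingNl L) ?(killingNr L) ab0 aNb0 Nab0 NaNb0 ?oppr0 !addr0 ?mulr0.
Qed.

Lemma killing_parts x y x' y' :
  B (x + 'i%C *: y) (x' + 'i%C *: y') =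
  B x x' + 'i%C * B x y' + 'i%C * (B y x' + 'i%C * B y y').
Proof.
by rewrite (killingDl L) (killingZl L) !(killingDr L) !(killingZr L).
Qed.

Lemma cbilinear_ext_metric_XX a b : a \in R_M D -> b \in R_M D ->
  cbilinear_ext m gm (X a) (X b) = - ((lam (kres a))%:C * B (X a) (X b)).
Proof.
move=> Ma Mb; have [[Aa Sa] [Ab Sb]] := (mspace_gens Ma, mspace_gens Mb).
have [Ha Ka] := mspace_weyl_parts Ma; have [Hb Kb] := mspace_weyl_parts Mb.
have [gl gr] := metric_bilinear.
have m0 : m 0 by exact: rspan0.
have g0l z : m z -> gm 0 z = 0.
  by move=> mz; have := gl (- 1) 0 0 z m0 m0 mz; rewrite scaler0 addr0 mulN1r addNr.
have g0r z : m z -> gm z 0 = 0.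
  by move=> mz; have := gr (- 1) 0 0 z m0 m0 mz; rewrite scaler0 addr0 mulN1r addNr.
have gE (k l : R) x y : m x -> m y ->
    x = X a - X (- a) \/ x = 'i%C *: (X a + X (- a)) ->
    y = X b - X (- b) \/ y = 'i%C *: (X b + X (- b)) ->
    (gm (k%:C *: x) (l%:C *: y))%:C =
    - ((lam (kres a))%:C * B (k%:C *: x) (l%:C *: y)).
  move=> mx my xE yE; have mly : m (l%:C *: y) by exact: rspanZ.
  rewrite -[k%:C *: x]addr0 gl // g0l // addr0 -[l%:C *: y]addr0 gr //.
  rewrite g0r // !addr0 !rmorphM /= (metric_gens Ma Mb xE yE).
  by rewrite (killingZl L) (killingZr L) !mulrN !(mulrCA _ (lam _)%:C).
pose xa := (2^-1)%:C *: (X a - X (- a)).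
pose ya := (- 2^-1)%:C *: ('i%C *: (X a + X (- a))).
pose xb := (2^-1)%:C *: (X b - X (- b)).
pose yb := (- 2^-1)%:C *: ('i%C *: (X b + X (- b))).
have aE : X a = xa + 'i%C *: ya by exact: weyl_vector_parts.
have bE : X b = xb + 'i%C *: yb by exact: weyl_vector_parts.
have -> : B (X a) (X b) = B xa xb + 'i%C * B xa yb
    + 'i%C * (B ya xb + 'i%C * B ya yb).
  by rewrite {1}aE {1}bE killing_parts.
rewrite {1}aE {1}bE cbilinear_ext_parts // !gE; try by [|left | right].
by rewrite !(mulrN, mulrDr, opprD) !(mulrCA 'i%C).
Qed.

Local Notation weight a := (eps (kres a) * lam (kres a)).

Lemma OmegaC_XX a b : a \in R_M D -> b \in R_M D ->
  OmegaC J gm (X a) (X b) = - ('i%C * (weight b)%:C * B (X a) (X b)).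
Proof.
move=> Ma Mb; have [XMa XMb] := (weyl_mem_mC Ma, weyl_mem_mC Mb).
rewrite OmegaC_JC // (eps_J Heps Mb).
have glin := cbilinear_ext_linearr metric_bilinear XMa.
have -> : cbilinear_ext m gm (X a) (('i%C * (eps (kres b))%:C) *: X b) =
    'i%C * (eps (kres b))%:C * cbilinear_ext m gm (X a) (X b).
  exact: (linear_on_mCZ _ glin XMb).
rewrite cbilinear_ext_metric_XX // mulrN rmorphM /= -!mulrA.
(* The metric supplies [lam] at [a] but [J] supplies [eps] at [b]. The pairing is nonzero only for
   $a=-b$, where [lam] agrees. *)
have [->|aNb] := eqVneq a (- b).
  have tb : R_t (kres b) by exists b.
  by rewrite kresN (lam_opp Hlam tb).
rewrite killing_XX_eq0 ?R_M_root ?addr_eq0 //.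
by rewrite !mulr0.
Qed.

(** * Projection of brackets to the tangent space *)

Lemma mC_capv_k_ThetaC : (mC D :&: k_ThetaC D)%VS = 0%VS.
Proof.
apply/eqP; rewrite -subv0; apply/subvP => x; rewrite memv_cap memv0.
case/andP=> /mC_coordinates xE xk; rewrite xE big_seq big1 // => a Ma.
have PNa := root_opp (R_M_root Ma).
suff -> : B x (X (- a)) = 0 by rewrite scale0r.
move: x xk {xE}; apply: span_ind => [|k x y xs y0]; first by rewrite killing0l.
rewrite (killingDl L) (killingZl L) y0 addr0.
suff -> : B x (X (- a)) = 0 by rewrite mulr0.
move: xs; rewrite mem_cat => /orP[/mapP[c Pc ->]|].
  by rewrite (killingZl L) killingC killing_Xh ?Hroot_cart ?mulr0.
case/mem_u_gens => c; rewrite mem_filter => /andP[_ Tc].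
have aT : a \notin R_Theta D by move: Ma; rewrite mem_filter => /andP[].
have TNc : - c \in R_Theta D.
  by move: Tc; rewrite !mem_R_Theta memvN => /andP[-> /root_opp].
have [Pa Pc PNc] := And3 (R_M_root Ma) (R_Theta_root Tc) (R_Theta_root TNc).
have ca0 : B (X c) (X (- a)) = 0.
  rewrite killing_XXN //.
  by case: eqVneq aT => // <-; rewrite Tc.
have Nca0 : B (X (- c)) (X (- a)) = 0.
  rewrite killing_XXN //.
  by case: eqVneq aT => // <-; rewrite TNc.
case=> ->; rewrite ?(killingZl L) !(killingDl L) ?(killingNl L) ca0 Nca0.
  by rewrite oppr0 addr0.
by rewrite addr0 mulr0.
Qed.

Lemma proj_mC_id x : x \in mC D -> proj_mC x = x.
Proof. exact: daddv_pi_id mC_capv_k_ThetaC. Qed.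

Lemma proj_mC_k x : x \in k_ThetaC D -> proj_mC x = 0.
Proof.
move=> kx; have kxm : x \in (mC D + k_ThetaC D)%VS by rewrite (subvP (addvSr _ _)).
have := daddv_pi_add mC_capv_k_ThetaC kxm; rewrite -/(proj_mC x).
rewrite (@daddv_pi_id _ _ (k_ThetaC D)) // 1?capvC ?mC_capv_k_ThetaC //.
by move/eqP; rewrite eq_sym -subr_eq subrr eq_sym => /eqP.
Qed.

Lemma Hroot_k_ThetaC a : a \in Phi -> Hroot a \in k_ThetaC D.
Proof.
move=> Pa; have iHk : 'i%C *: Hroot a \in k_ThetaC D.
  by apply: memv_span; rewrite mem_cat; apply/orP; left; exact: map_f.
have := memvZ (- 'i%C) iHk.
by rewrite scalerA mulNr -expr2 sqr_i opprK scale1r.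
Qed.

Lemma weyl_k_ThetaC a : a \in R_Theta D -> X a \in k_ThetaC D.
Proof.
move=> Ta; have gens c x : c \in R_Theta_pos D ->
    x = X c - X (- c) \/ x = 'i%C *: (X c + X (- c)) -> x \in k_ThetaC D.
  move=> Tc xE; apply: memv_span; rewrite mem_cat; apply/orP; right.
  by apply/mem_u_gens; exists c.
have posE c : (c \in R_Theta_pos D) = `[< root_pos c >] && (c \in R_Theta D).
  exact: mem_filter.
have [_ _ /(_ a (R_Theta_root Ta))] := simpP D.
move=> pa; suff [kA kS] : X a - X (- a) \in k_ThetaC D /\
    'i%C *: (X a + X (- a)) \in k_ThetaC D.
  rewrite weyl_vector_parts; apply: memvD; first exact: memvZ.
  by apply: memvZ; apply: memvZ.
case: pa => pa.
  have Tpa : a \in R_Theta_pos D by rewrite posE Ta andbT; apply/asboolP.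
  by split; apply: (gens a) => //; [left | right].
have TNa : - a \in R_Theta_pos D.
  rewrite posE; apply/andP; split; first exact/asboolP.
  by move: Ta; rewrite !mem_R_Theta memvN => /andP[-> /root_opp].
split; first by rewrite -opprB memvN (gens (- a)) // opprK; left.
by rewrite addrC (gens (- a)) // opprK; right.
Qed.

Lemma OmegaC0l z : z \in mC D -> OmegaC J gm 0 z = 0.
Proof. by move=> mz; exact: (linear_on_mC0 (OmegaC_linearl mz)). Qed.

(** The projection costs nothing: a bracket falling into [k_ThetaC] is Killing-orthogonal to [X c],
    so both sides vanish there. *)
Lemma OmegaC_br a b c : a \in R_M D -> b \in R_M D -> c \in R_M D ->
  OmegaC J gm (proj_mC {[ X a, X b ]}) (X c) =
  - ('i%C * (weight c)%:C * B {[ X a, X b ]} (X c)).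
Proof.
move=> Ma Mb Mc; have XMc := weyl_mem_mC Mc.
have [Pa Pb Pc] := And3 (R_M_root Ma) (R_M_root Mb) (R_M_root Mc).
have [ab0|ab0] := eqVneq (a + b) 0.
  have -> : b = - a by apply/eqP; rewrite -addr_eq0 addrC ab0.
  rewrite -HrootE // proj_mC_k ?Hroot_k_ThetaC // OmegaC0l //.
  by rewrite killingC killing_Xh ?Hroot_cart // mulr0 oppr0.
rewrite (weyl_br W) //; have [Pab|nPab] := boolP (a + b \in Phi); last first.
  rewrite nstr_eq0 // scale0r proj_mC_k ?mem0v // OmegaC0l // killing0l //.
  by rewrite mulr0 oppr0.
have [Mab|] := boolP (a + b \in R_M D); last first.
  rewrite mem_filter Pab andbT negbK => Tab.
  rewrite proj_mC_k ?memvZ ?weyl_k_ThetaC // OmegaC0l // (killingZl L).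
  rewrite killing_XX_eq0 ?mulr0 ?oppr0 // addr_eq0.
  apply: contraTneq Tab => ->.
  by have := R_M_opp Mc; rewrite mem_filter => /andP[].
have XMab := weyl_mem_mC Mab.
rewrite proj_mC_id ?memvZ //.
have -> : OmegaC J gm ((n a b)%:C *: X (a + b)) (X c) =
    (n a b)%:C * OmegaC J gm (X (a + b)) (X c).
  exact: (linear_on_mCZ _ (OmegaC_linearl XMc) XMab).
by rewrite OmegaC_XX // (killingZl L) mulrN [in RHS]mulrCA.
Qed.

Lemma dOmega_XXX a b c : a \in R_M D -> b \in R_M D -> c \in R_M D ->
  dOmega J gm (X a) (X b) (X c) =
  3%:R^-1 * ('i%C * (weight a + weight b + weight c)%:C
             * B {[ X a, X b ]} (X c)).
Proof.
move=> Ma Mb Mc; rewrite /dOmega !OmegaC_br //; congr (_ * _).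
(* The form $B([x,y],z)$ is totally antisymmetric, so the three terms share one factor. *)
have -> : B {[ X a, X c ]} (X b) = - B {[ X a, X b ]} (X c).
  by rewrite !(killing_br L) (brC L (X c)) (killingNr L).
have -> : B {[ X b, X c ]} (X a) = B {[ X a, X b ]} (X c).
  by rewrite (killing_br L (X a)) killingC.
rewrite !opprK mulrN opprK -!mulrDl -!mulrDr -!rmorphD.
by rewrite -(addrA (weight c)) (addrC (weight c)) (addrC (weight b)).
Qed.

(** * Trilinearity of the exterior derivative *)

Lemma br_proj_mC_linearl y : linear_on_mC (fun x => proj_mC {[ x, y ]}).
Proof.
by move=> k x z _ _; rewrite (brDl L) (brZl L) /proj_mC linearD linearZ.
Qed.

Lemma proj_mC_mem x : proj_mC x \in mC D.
Proof. exact: memv_pi. Qed.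

Let dOmega_scalar (k u v w u' v' w' : C) :
  3%:R^-1 * (- (k * u + u') + (k * v + v') - (k * w + w')) =
  k * (3%:R^-1 * (- u + v - w)) + 3%:R^-1 * (- u' + v' - w').
Proof. by ring. Qed.

Lemma dOmega_linear1 y z : y \in mC D -> z \in mC D ->
  linear_on_mC (fun x => dOmega J gm x y z : C^o).
Proof.
move=> my mz k x x' mx mx'; rewrite /dOmega.
rewrite !br_proj_mC_linearl // (OmegaC_linearl mz) ?proj_mC_mem //.
rewrite (OmegaC_linearl my) ?proj_mC_mem // (OmegaC_linearr (proj_mC_mem _)) //.
exact: dOmega_scalar.
Qed.

Lemma OmegaC_brC x y z : z \in mC D ->
  OmegaC J gm (proj_mC {[ y, x ]}) z = - OmegaC J gm (proj_mC {[ x, y ]}) z.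
Proof.
move=> mz; rewrite (brC L) -scaleN1r /proj_mC linearZ.
rewrite (linear_on_mCZ _ (OmegaC_linearl mz)) ?proj_mC_mem //.
exact: scaleN1r.
Qed.

(** With [dOmegaC23], this brings any argument to the first slot, where [dOmega_linear1] gives
    linearity. *)
Lemma dOmegaC12 x y z : x \in mC D -> y \in mC D -> z \in mC D ->
  dOmega J gm x y z = - dOmega J gm y x z.
Proof.
move=> mx my mz; rewrite /dOmega (OmegaC_brC x y) //.
by rewrite -mulrN !opprD !opprK addrAC.
Qed.

Lemma dOmegaC23 x y z : x \in mC D -> y \in mC D -> z \in mC D ->
  dOmega J gm x y z = - dOmega J gm x z y.
Proof.
move=> mx my mz; rewrite /dOmega (OmegaC_brC y z) //.
by rewrite -mulrN !opprD !opprK (addrC (OmegaC _ _ _ _)).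
Qed.

Lemma dOmega_span_eq0 (s1 s2 s3 : seq (dual h)) (f1 f2 f3 : dual h -> C) :
  {subset s1 <= R_M D} -> {subset s2 <= R_M D} -> {subset s3 <= R_M D} ->
  (forall a b c, a \in s1 -> b \in s2 -> c \in s3 ->
    dOmega J gm (X a) (X b) (X c) = 0) ->
  dOmega J gm (\sum_(a <- s1) f1 a *: X a) (\sum_(a <- s2) f2 a *: X a)
    (\sum_(a <- s3) f3 a *: X a) = 0.
Proof.
move=> sM1 sM2 sM3 XXX0.
have span_mC s f : {subset s <= R_M D} -> \sum_(a <- s) f a *: X a \in mC D.
  by move=> sM; rewrite big_seq memv_suml // => a /sM Ma; rewrite memvZ ?weyl_mem_mC.
have my := span_mC s2 f2 sM2; have mz := span_mC s3 f3 sM3.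
rewrite (linear_on_mC_sum f1 (dOmega_linear1 my mz) sM1) big_seq big1 // => a sa.
have mXa := weyl_mem_mC (sM1 _ sa).
rewrite dOmegaC12 // (linear_on_mC_sum f2 (dOmega_linear1 mXa mz) sM2).
rewrite big_seq big1 ?oppr0 ?scaler0 // => b sb.
have mXb := weyl_mem_mC (sM2 _ sb).
rewrite dOmegaC12 // dOmegaC23 // dOmegaC12 //.
rewrite (linear_on_mC_sum f3 (dOmega_linear1 mXa mXb) sM3).
rewrite big_seq big1 ?oppr0 ?scaler0 // => c sc.
have mXc := weyl_mem_mC (sM3 _ sc).
by rewrite dOmegaC12 // dOmegaC23 // XXX0 // !oppr0 scaler0.
Qed.

(** Comparing coordinates in the eigenvalue equation kills those with sign different from [s]; $s=1$
    and $s=-1$ give the two types. *)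
Lemma eigenvector_JC_span (s : R) z : z \in mC D ->
  JC J z = ('i%C * s%:C) *: z ->
  z = \sum_(a <- [seq a <- R_M D | eps (kres a) == s]) B z (X (- a)) *: X a.
Proof.
move=> mz Jz; rewrite {1}(mC_coordinates mz) [RHS]big_filter.
rewrite [RHS]big_mkcond; apply: eq_big_seq => a Ma.
case: ifPn => // es; suff -> : B z (X (- a)) = 0 by rewrite scale0r.
have := congr1 (fun u => B u (X (- a))) Jz.
rewrite {1}(mC_coordinates mz).
rewrite (linear_on_mC_sum _ JC_linear) // (killing_suml L) (killingZl L).
rewrite (bigD1_seq a) ?filter_uniq ?roots_uniq //= big_seq_cond big1 => [|b].
  rewrite addr0 (eps_J Heps Ma) !(killingZl L) killing_XXN ?R_M_root // eqxx mulr1.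
  rewrite mulrC => /eqP; rewrite -subr_eq0 -mulrBl mulf_eq0 => /orP[|/eqP //].
  rewrite -mulrBr mulf_eq0 eq_complex /= oner_eq0 andbF /= -rmorphB.
  by rewrite fmorph_eq0 subr_eq0 (negPf es).
case/andP=> Mb ba; rewrite (eps_J Heps Mb) !(killingZl L).
by rewrite killing_XXN ?R_M_root // (negPf ba) !mulr0.
Qed.

Lemma type10_span z : type10 J z ->
  z = \sum_(a <- [seq a <- R_M D | eps (kres a) == 1]) B z (X (- a)) *: X a.
Proof.
by case=> mz Jz; apply: eigenvector_JC_span; rewrite // rmorph1 mulr1.
Qed.

Lemma type01_span z : type01 J z ->
  z = \sum_(a <- [seq a <- R_M D | eps (kres a) == -1]) B z (X (- a)) *: X a.
Proof.
by case=> mz Jz; apply: eigenvector_JC_span; rewrite // rmorphN1 mulrN1.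
Qed.

Lemma type10_X a : a \in R_M D -> eps (kres a) = 1 -> type10 J (X a).
Proof.
move=> Ma ea; split; first exact: weyl_mem_mC.
by rewrite (eps_J Heps Ma) ea rmorph1 mulr1.
Qed.

Lemma type01_X a : a \in R_M D -> eps (kres a) = -1 -> type01 J (X a).
Proof.
move=> Ma ea; split; first exact: weyl_mem_mC.
by rewrite (eps_J Heps Ma) ea rmorphN1 mulrN1.
Qed.

Lemma R_t_kres a : a \in R_M D -> R_t (kres a).
Proof. by exists a. Qed.

Lemma triples_quasi_kahler :
  (forall d z e : tdual D, triple12 eps d z e ->
     eps d * lam d + eps z * lam z + eps e * lam e = 0) ->
  quasi_kahler J gm.
Proof.
move=> sum0.
(* If the roots do not sum to zero, the Killing factor of [dOmega_XXX] vanishes; if they do, their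
   restrictions form a (1,2)-triple and the weights cancel. *)
have dO a b c : a \in R_M D -> b \in R_M D -> c \in R_M D ->
    ~ (eps (kres a) = eps (kres b) /\ eps (kres b) = eps (kres c)) ->
    dOmega J gm (X a) (X b) (X c) = 0.
  move=> Ma Mb Mc Nabc; rewrite dOmega_XXX //.
  have [Pa Pb Pc] := And3 (R_M_root Ma) (R_M_root Mb) (R_M_root Mc).
  have [ab0|ab0] := eqVneq (a + b) 0.
    have -> : b = - a by apply/eqP; rewrite -addr_eq0 addrC ab0.
    by rewrite -HrootE // killingC killing_Xh ?Hroot_cart // !mulr0.
  rewrite (weyl_br W) // (killingZl L).
  have [abc0|abc0] := eqVneq (a + b + c) 0; last first.
    have [Pab|nPab] := boolP (a + b \in Phi).
      by rewrite killing_XX_eq0 // !mulr0.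
    by rewrite nstr_eq0 // mul0r !mulr0.
  have -> : weight a + weight b + weight c = 0.
    apply: sum0; split; last by case.
    split; try exact: R_t_kres.
    by rewrite -!kresD abc0; apply/funext => H; exact: ev0.
  by rewrite rmorph0 mulr0 mul0r mulr0.
have sub s : {subset [seq a <- R_M D | eps (kres a) == s] <= R_M D}.
  by move=> a; rewrite mem_filter => /andP[].
have ne : (1 : R) <> -1.
  by move/eqP; rewrite -subr_eq0 opprK -mulr2n pnatr_eq0.
have van s1 s2 s3 (f1 f2 f3 : dual h -> C) : ~ (s1 = s2 /\ s2 = s3) ->
  dOmega J gm (\sum_(a <- [seq a <- R_M D | eps (kres a) == s1]) f1 a *: X a)
    (\sum_(a <- [seq a <- R_M D | eps (kres a) == s2]) f2 a *: X a)
    (\sum_(a <- [seq a <- R_M D | eps (kres a) == s3]) f3 a *: X a) = 0.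
  move=> Ns; apply: dOmega_span_eq0 => //; try exact: sub.
  move=> a b c; rewrite !(mem_filter (fun a => eps (kres a) == _)).
  move=> /andP[/eqP ea Ma] /andP[/eqP eb Mb] /andP[/eqP ec Mc].
  by apply: dO; rewrite // ea eb ec.
move=> x y z [] [].
- move=> /type10_span -> /type01_span -> /type01_span ->.
  by apply: van => -[].
- move=> /type01_span -> /type10_span -> /type01_span ->.
  by apply: van => -[/esym].
move=> /type01_span -> /type01_span -> /type10_span ->.
by apply: van => -[_ /esym].
Qed.

(** The definition tests exactly one argument of type (1,0), that is one plus sign. A triple with
    two plus signs is treated through its negative, whose weighted sum is opposite. *)
Lemma quasi_kahler_triples : quasi_kahler J gm ->
  forall d z e : tdual D, triple12 eps d z e ->
    eps d * lam d + eps z * lam z + eps e * lam e = 0.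
Proof.
move=> qk.
have mixed a b : a \in R_M D -> b \in R_M D -> a + b \in R_M D ->
    let c := - (a + b) in
    [\/ [/\ eps (kres a) = 1, eps (kres b) = -1 & eps (kres c) = -1],
        [/\ eps (kres a) = -1, eps (kres b) = 1 & eps (kres c) = -1]
      | [/\ eps (kres a) = -1, eps (kres b) = -1 & eps (kres c) = 1]] ->
    weight a + weight b + weight c = 0.
  move=> Ma Mb Mab c signs; have Mc : c \in R_M D by exact: R_M_opp.
  have [Pa Pb Pab] := And3 (R_M_root Ma) (R_M_root Mb) (R_M_root Mab).
  have : dOmega J gm (X a) (X b) (X c) = 0.
    apply: qk; case: signs => -[ea eb ec].
    - by apply: Or31; split; [exact: type10_X | exact: type01_X..].
    - by apply: Or32; split; [exact: type01_X | exact: type10_X | exact: type01_X].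
    by apply: Or33; split; [exact: type01_X.. | exact: type10_X].
  (* The Killing factor is [n a b], nonzero since $a+b$ is a root, so the sum of weights must
     vanish. *)
  rewrite dOmega_XXX // (weyl_br W) ?root_neq0 // (killingZl L) killing_XXN // eqxx.
  move/eqP; rewrite mulr1 !mulf_eq0 invr_eq0 pnatr_eq0 /= eq_complex /= oner_eq0.
  rewrite andbF /= !fmorph_eq0 orbC (negPf (_ : n a b != 0)) ?(weyl_n0 W) //=.
  by move/eqP.
move=> d z e [dze N03]; have [td tz te sum0] := dze.
have [[a Ma dE] [b Mb zE] [c Mc eE]] := And3 td tz te.
have abc : kres a + kres b = kres (- c).
  by rewrite kresN -dE -zE -eE; apply/eqP; rewrite -addr_eq0 sum0.
have [a' [b' [Ma' Mb' Mab' ka kb]]] := kres_add_lift Ma Mb (R_M_opp Mc) abc.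
have kab : kres (a' + b') = - e by rewrite kresD ka kb abc kresN eE.
have MNab : - a' + - b' \in R_M D by rewrite -opprD R_M_opp.
have := mixed _ _ (R_M_opp Ma') (R_M_opp Mb') MNab.
have := mixed _ _ Ma' Mb' Mab'.
rewrite /= -opprD opprK !kresN kab opprK ka kb -dE -zE.
rewrite (eps_opp Heps td) (eps_opp Heps tz) (eps_opp Heps te).
rewrite (lam_opp Hlam td) (lam_opp Hlam tz) (lam_opp Hlam te).
rewrite !mulNr -!opprD => pos neg.
have {}neg q := oppr_inj (etrans (neg q) (esym (oppr0 _))).
have eq3 : eps d = eps z -> eps z = eps e -> False.
  by move=> dz zE'; apply: N03; split.
(* Of the eight sign patterns, the constant ones contradict [N03], [pos] settles those with one plus
   sign and [neg] those with two. *)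
move: pos neg eq3; case: (eps_pm1 Heps td) => ->;
  case: (eps_pm1 Heps tz) => ->; case: (eps_pm1 Heps te) => ->; rewrite ?opprK.
all: move=> pos neg eq3; first
  [ by case: eq3
  | apply: pos; first [exact: Or31 | exact: Or32 | exact: Or33]
  | apply: neg; first [exact: Or31 | exact: Or32 | exact: Or33] ].
Qed.

End FlagManifold.

Theorem proposition6p6 (R : realType) (D : flag_setting R)
    (J : lie D -> lie D) (gm : lie D -> lie D -> R)
    (eps lam : tdual D -> R)
    (HJ : invariant_acs J) (Heps : acs_signs J eps)
    (Hg : invariant_metric gm) (Hlam : metric_coefs gm lam) :
  quasi_kahler J gm <->
  (forall delta zeta eta : tdual D, triple12 eps delta zeta eta ->
     eps delta * lam delta + eps zeta * lam zeta + eps eta * lam eta = 0).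
Proof.
split; first exact: quasi_kahler_triples HJ Heps Hg Hlam.
exact: triples_quasi_kahler HJ Heps Hg Hlam.
Qed.
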